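(* The logic UMLFI1 is sound, strongly complete, compact and decidable. That is: (1) for all $\Gamma\cup\{\alpha\}\subseteq\mathcal{L}$, $\Gamma\vdash_{UMLFI1}\alpha$ if and only if $\Gamma\vDash_{UMLFI1}\alpha$; (2) for all $\Gamma\cup\{\alpha\}\subseteq\mathcal{L}$, if $\Gamma\vDash_{UMLFI1}\alpha$ then there is a finite $\Gamma'\subseteq\Gamma$ with $\Gamma'\vDash_{UMLFI1}\alpha$; (3) there is an effective procedure that, given any $\alpha\in\mathcal{L}$, determines in finitely many steps whether $\alpha$ is satisfiable; if $\alpha$ is satisfiable it determines a model and state $s$ with $\vartheta_s(\alpha)\in\{1,\tfrac12\}$, and if $\alpha$ is not satisfiable it determines a model and state $s$ with $\vartheta_s(\alpha)=0$.
   Context: **Language.** $P$ is a countable set of propositional variables and $N$ a finite set of agents. The formulas of the language $\mathcal{L}$ and the update models are defined by simultaneous recursion. Formulas: $\alpha ::= p \mid \neg\alpha \mid \bullet\alpha \mid (\alpha\land\alpha) \mid K_i\alpha \mid [U,e]\alpha$, with $p\in P$, $i\in N$, $U$ an update model and $e$ an action of $U$. An update model is $U=\langle E,\{\sim_i\}_{i\in N},\mathrm{pre},\mathrm{post}\rangle$ with $E$ a finite non-empty set of actions, each $\sim_i$ an equivalence relation on $E$, $\mathrm{pre}:E\to\mathcal{L}$ (preconditions), and $\mathrm{post}$ assigning to each $e\in E$ and $p\in P$ a formula $\mathrm{post}(e)(p)\in\mathcal{L}$ (postconditions), with $\mathrm{post}(e)(p)=p$ for all but finitely many $p$. **Abbreviations.**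 $\circ\alpha:=\neg\bullet\alpha$; $\alpha\lor\beta:=\neg(\neg\alpha\land\neg\beta)$; $\sim\!\alpha:=\neg\alpha\land\circ\alpha$; $\alpha\to\beta:=\ \sim\!\alpha\lor\beta$; $\alpha\leftrightarrow\beta:=(\alpha\to\beta)\land(\beta\to\alpha)$; $\alpha\equiv\beta:=(\alpha\leftrightarrow\beta)\land(\neg\alpha\leftrightarrow\neg\beta)$; $\hat K_i\alpha:=\neg K_i\neg\alpha$. **Proof system UMLFI1** (all schemata range over formulas of $\mathcal{L}$, $i\in N$, $p\in P$). LFI1 part: A1 $\alpha\to(\beta\to\alpha)$; A2 $(\alpha\to(\beta\to\gamma))\to((\alpha\to\beta)\to(\alpha\to\gamma))$; A3 $\alpha\to(\beta\to(\alpha\land\beta))$; A4 $(\alpha\land\beta)\to\alpha$; A5 $(\alpha\land\beta)\to\beta$; A6 $\alpha\to(\alpha\lor\beta)$; A7 $\beta\to(\alpha\lor\beta)$; A8 $(\alpha\to\gamma)\to((\beta\to\gamma)\to((\alpha\lor\beta)\to\gamma))$; A9 $\alpha\lor(\alpha\to\beta)$; A10 $\alpha\lor\neg\alpha$; A11 $\circ\alpha\to(\alpha\to(\neg\alpha\to\beta))$; A12 $\bullet\alpha\to(\alpha\land\neg\alpha)$; A13 $\neg\neg\alpha\leftrightarrow\alpha$; A14 $\neg(\alpha\lor\beta)\leftrightarrow(\neg\alpha\land\neg\beta)$; A15 $\neg(\alpha\land\beta)\leftrightarrow(\neg\alpha\lor\neg\beta)$; A16 $\neg(\alpha\to\beta)\leftrightarrow(\alpha\land\neg\beta)$;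 rule MP: $\alpha,\alpha\to\beta\Rightarrow\beta$. Modal (S5LFI1) part: K $K_i(\alpha\to\beta)\to(K_i\alpha\to K_i\beta)$; K$_1$ $K_i(\alpha\to\beta)\to(\hat K_i\alpha\to\hat K_i\beta)$; K$_2$ $\hat K_i(\alpha\lor\beta)\to(\hat K_i\alpha\lor\hat K_i\beta)$; K$_3$ $(\hat K_i\alpha\to K_i\beta)\to K_i(\alpha\to\beta)$; T $K_i\alpha\to\alpha$; 4 $K_i\alpha\to K_iK_i\alpha$; 5 $\hat K_i\alpha\to K_i\hat K_i\alpha$; T$'$ $\alpha\to\hat K_i\alpha$; 4$'$ $\hat K_i\hat K_i\alpha\to\hat K_i\alpha$; 5$'$ $\hat K_iK_i\alpha\to K_i\alpha$; rule Nec: $\alpha\Rightarrow K_i\alpha$. Dynamic part: UM1 $[U,e]p\equiv(\mathrm{pre}(e)\to\mathrm{post}(e)(p))$; AM2 $[U,e]\neg\alpha\equiv(\mathrm{pre}(e)\to\neg[U,e]\alpha)$; AM3 $[U,e]\bullet\alpha\equiv(\mathrm{pre}(e)\to\bullet[U,e]\alpha)$; AM4 $[U,e](\alpha\land\beta)\equiv([U,e]\alpha\land[U,e]\beta)$; AM5 $[U,e]K_i\alpha\equiv(\mathrm{pre}(e)\to\bigwedge_{e\sim_i f}K_i[U,f]\alpha)$; rule RE: $\theta\equiv\gamma\Rightarrow\alpha\equiv\alpha(\theta/\gamma)$, where $\alpha(\theta/\gamma)$ is $\alpha$ with occurrences of $\theta$ replaced by $\gamma$ (in $[U,e]\delta$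 the replacement acts in $\delta$; the update model is left unchanged). $\Gamma\vdash_{UMLFI1}\alpha$ means there is a finite derivation of $\alpha$ from axioms and members of $\Gamma$, where MP may be applied to any formulas already obtained, while all other rules (Nec, RE) may be applied only to theorems, i.e. formulas derivable from $\emptyset$. **Semantics.** Truth values $\{0,\tfrac12,1\}$, designated values $D=\{1,\tfrac12\}$. A Kripke model is $M=\langle S,\{\sim_i\}_{i\in N},\vartheta\rangle$ with $S$ a set of states, each $\sim_i$ an equivalence relation on $S$, and for each $s\in S$ a map $\vartheta_s:P\to\{0,\tfrac12,1\}$, extended to formulas by: $\vartheta_s(\neg\alpha)=1-\vartheta_s(\alpha)$; $\vartheta_s(\bullet\alpha)=1$ if $\vartheta_s(\alpha)=\tfrac12$ and $0$ otherwise; $\vartheta_s(\alpha\land\beta)=\min\{\vartheta_s(\alpha),\vartheta_s(\beta)\}$; $\vartheta_s(K_i\alpha)=\inf\{\vartheta_{t}(\alpha):s\sim_i t\}$ (with $\inf\emptyset=1$); $\vartheta_s([U,e]\alpha)=\vartheta'_{(s,e)}(\alpha)$ if $\vartheta_s(\mathrm{pre}(e))\in D$, and $1$ otherwise. Here $\vartheta'$ is the valuation of the updated model $M\otimes U=\langle S',\{\sim_i'\},\vartheta'\rangle$ with $S'=\{(t,f):t\in S,f\in E,\vartheta_t(\mathrm{pre}(f))\in D\}$, $(t,f)\sim'_i(u,g)$ iff $t\sim_i u$ and $f\sim_i g$, and $\vartheta'_{(t,f)}(p)=\vartheta_t(\mathrm{post}(f)(p))$ for $p\in P$. $\Gamma\vDash_{UMLFI1}\alpha$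 means: for every such model and every state $s$, if $\vartheta_s(\gamma)\in D$ for all $\gamma\in\Gamma$ then $\vartheta_s(\alpha)\in D$. A formula $\alpha$ is satisfiable if $\vartheta_s(\alpha)\in D$ for some such model and state. *)

(* Defs.v *)
From Stdlib Require Import RelationClasses.
From mathcomp Require Import all_boot.
From mathcomp Require Import boolp classical_sets cardinality.

Set Implicit Arguments.
Unset Strict Implicit.
Unset Printing Implicit Defensive.

Local Open Scope classical_set_scope.

(** * Language *)

Section Language.
Context (P : countType) (N : finType).

(* A finite S5 frame on n.+1 points, used both for the actions of an update
   model and for the states of a finitely presented Kripke model. *)
Record frame (n : nat) := Frame {
  frel : N -> rel 'I_n.+1;
  frel_equiv : forall i,
    [/\ reflexive (frel i), symmetric (frel i) & transitive (frel i)] }.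

(* The value at p of the finite-support function listed by s, equal to d off
   the list; the first binding of p counts. *)
Fixpoint lookup (A : Type) (d : A) (s : seq (P * A)) (p : P) : A :=
  if s is b :: s' then if b.1 == p then b.2 else lookup d s' p else d.

(* The set of actions is 'I_n.+1.  The list [binds f] presents the
   postconditions of f: variables that are not listed are unchanged (see
   [post] below), so that post(f)(p) = p for all but finitely many p. *)
Record umodel (L : Type) (n : nat) := UModel {
  uframe : frame n;
  pre : 'I_n.+1 -> L;
  binds : 'I_n.+1 -> seq (P * L) }.

Inductive form : Type :=
  | Var of P
  | Neg of form
  | Inc of form
  | And of form & form
  | Know of N & form
  | Upd n of umodel form n & 'I_n.+1 & form.

Definition post n (U : umodel form n) (e : 'I_n.+1) (p : P) : form :=
  lookup (Var p) (binds U e) p.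

Definition Cons (a : form) := Neg (Inc a).
Definition Or (a b : form) := Neg (And (Neg a) (Neg b)).
Definition SNeg (a : form) := And (Neg a) (Cons a).
Definition Imp (a b : form) := Or (SNeg a) b.
Definition Iff (a b : form) := And (Imp a b) (Imp b a).
Definition Equ (a b : form) := And (Iff a b) (Iff (Neg a) (Neg b)).
Definition Poss (i : N) (a : form) := Neg (Know i (Neg a)).

(* All occurrences of t in a are replaced by g; update models are unchanged. *)
Fixpoint repl (t g a : form) : form :=
  if `[< a = t >] then g else
  match a with
  | Var p => Var p
  | Neg b => Neg (repl t g b)
  | Inc b => Inc (repl t g b)
  | And b c => And (repl t g b) (repl t g c)
  | Know i b => Know i (repl t g b)
  | Upd n U e b => Upd U e (repl t g b)
  end.

(* The conjunction of the K_i [U,f] a over the f such that e ~_i f: first e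
   itself, then the other such f in increasing order, bracketed to the left. *)
Definition KnowUpd n (U : umodel form n) (e : 'I_n.+1) i (a : form) : form :=
  foldl And (Know i (Upd U e a))
    [seq Know i (Upd U f a) |
      f <- enum 'I_n.+1 & (f != e) && frel (uframe U) i e f].

(** * Proof system *)

Declare Scope form_scope.
Local Open Scope form_scope.
Local Notation "- a" := (Neg a) (at level 35, right associativity) : form_scope.
Local Infix "⊓" := And (at level 45, left associativity) : form_scope.
Local Infix "⊔" := Or (at level 46, left associativity) : form_scope.
Local Infix "⊃" := Imp (at level 60, right associativity) : form_scope.
Local Infix "⇔" := Iff (at level 65, no associativity) : form_scope.
Local Infix "≡" := Equ (at level 65, no associativity) : form_scope.

Inductive ax : form -> Prop :=
  | A1 a b : ax (a ⊃ (b ⊃ a))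
  | A2 a b c : ax ((a ⊃ (b ⊃ c)) ⊃ ((a ⊃ b) ⊃ (a ⊃ c)))
  | A3 a b : ax (a ⊃ (b ⊃ (a ⊓ b)))
  | A4 a b : ax ((a ⊓ b) ⊃ a)
  | A5 a b : ax ((a ⊓ b) ⊃ b)
  | A6 a b : ax (a ⊃ (a ⊔ b))
  | A7 a b : ax (b ⊃ (a ⊔ b))
  | A8 a b c : ax ((a ⊃ c) ⊃ ((b ⊃ c) ⊃ ((a ⊔ b) ⊃ c)))
  | A9 a b : ax (a ⊔ (a ⊃ b))
  | A10 a : ax (a ⊔ - a)
  | A11 a b : ax (Cons a ⊃ (a ⊃ (- a ⊃ b)))
  | A12 a : ax (Inc a ⊃ (a ⊓ - a))
  | A13 a : ax (- - a ⇔ a)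
  | A14 a b : ax (- (a ⊔ b) ⇔ (- a ⊓ - b))
  | A15 a b : ax (- (a ⊓ b) ⇔ (- a ⊔ - b))
  | A16 a b : ax (- (a ⊃ b) ⇔ (a ⊓ - b))
  | AxK i a b : ax (Know i (a ⊃ b) ⊃ (Know i a ⊃ Know i b))
  | AxK1 i a b : ax (Know i (a ⊃ b) ⊃ (Poss i a ⊃ Poss i b))
  | AxK2 i a b : ax (Poss i (a ⊔ b) ⊃ (Poss i a ⊔ Poss i b))
  | AxK3 i a b : ax ((Poss i a ⊃ Know i b) ⊃ Know i (a ⊃ b))
  | AxT i a : ax (Know i a ⊃ a)
  | Ax4 i a : ax (Know i a ⊃ Know i (Know i a))
  | Ax5 i a : ax (Poss i a ⊃ Know i (Poss i a))
  | AxT' i a : ax (a ⊃ Poss i a)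
  | Ax4' i a : ax (Poss i (Poss i a) ⊃ Poss i a)
  | Ax5' i a : ax (Poss i (Know i a) ⊃ Know i a)
  | UM1 n (U : umodel form n) e p :
      ax (Upd U e (Var p) ≡ (pre U e ⊃ post U e p))
  | AM2 n (U : umodel form n) e a :
      ax (Upd U e (- a) ≡ (pre U e ⊃ - Upd U e a))
  | AM3 n (U : umodel form n) e a :
      ax (Upd U e (Inc a) ≡ (pre U e ⊃ Inc (Upd U e a)))
  | AM4 n (U : umodel form n) e a b :
      ax (Upd U e (a ⊓ b) ≡ (Upd U e a ⊓ Upd U e b))
  | AM5 n (U : umodel form n) e i a :
      ax (Upd U e (Know i a) ≡ (pre U e ⊃ KnowUpd U e i a)).

Inductive derives : set form -> form -> Prop :=
  | d_hyp G a : G a -> derives G a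
  | d_ax G a : ax a -> derives G a
  | d_mp G a b : derives G a -> derives G (a ⊃ b) -> derives G b
  | d_nec G i a : derives set0 a -> derives G (Know i a)
  | d_re G t g a : derives set0 (t ≡ g) -> derives G (a ≡ repl t g a).

End Language.

(** * Semantics *)

(* The truth values 0, 1/2 and 1. *)
Inductive tv := V0 | Vh | V1.

Definition designated (x : tv) : bool := if x is V0 then false else true.

Definition tneg (x : tv) := match x with V0 => V1 | Vh => Vh | V1 => V0 end.

Definition tinc (x : tv) := if x is Vh then V1 else V0.

Definition tmin (x y : tv) :=
  match x, y with
  | V0, _ | _, V0 => V0
  | Vh, _ | _, Vh => Vh
  | V1, V1 => V1
  end.

Definition tinf (A : set tv) : tv :=
  if `[< A V0 >] then V0 else if `[< A Vh >] then Vh else V1.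

Section Semantics.
Context (P : countType) (N : finType).

Record model := Model {
  state :> Type;
  acc : N -> state -> state -> Prop;
  acc_equiv : forall i, Equivalence (acc i);
  valu : state -> P -> tv }.

Section Product.
Context (M : model) (n : nat) (F : frame N n).
Context (d : M * 'I_n.+1 -> bool) (v : M * 'I_n.+1 -> P -> tv).

Definition product_acc i (x y : {x : M * 'I_n.+1 | d x}) : Prop :=
  acc i (val x).1 (val y).1 /\ frel F i (val x).2 (val y).2.

Lemma product_acc_equiv i : Equivalence (product_acc i).
Proof.
have [R S T] := acc_equiv M i; have [r s t] := frel_equiv F i.
split=> [x|x y [? ?]|x y z [? ?] [? ?]]; split=> //.
- exact: S.
- by rewrite s.
- exact: T (val y).1 _ _ _.
- exact: t (val y).2 _ _ _ _.
Qed.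

Definition product : model :=
  @Model {x : M * 'I_n.+1 | d x} product_acc product_acc_equiv
    (fun x => v (val x)).

End Product.

(* Structural recursion requires the valuation of the updated model to be
   written by mapping over the list of bindings; [eval_Upd] below gives the
   defining clause in terms of [post]. *)
Fixpoint eval (a : form P N) : forall M : model, M -> tv :=
  match a with
  | Var p => fun M s => valu s p
  | Neg b => fun M s => tneg (eval b s)
  | Inc b => fun M s => tinc (eval b s)
  | And b c => fun M s => tmin (eval b s) (eval c s)
  | Know i b => fun M s => tinf [set eval b t | t in acc i s]
  | Upd n U e b => fun M s =>
      let d := fun x : M * 'I_n.+1 => designated (eval (pre U x.2) x.1) in
      let v := fun (x : M * 'I_n.+1) p =>
        lookup (valu x.1 p) [seq (c.1, eval c.2 x.1) | c <- binds U x.2] p in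
      if (insub (s, e) : option {x | d x}) is Some x
      then @eval b (product (uframe U) d v) x else V1
  end.

Definition update (M : model) n (U : umodel P N (form P N) n) : model :=
  product (uframe U)
    (fun x : M * 'I_n.+1 => designated (eval (pre U x.2) x.1))
    (fun (x : M * 'I_n.+1) p => eval (post U x.2 p) x.1).

Lemma eval_Upd (M : model) n (U : umodel P N (form P N) n) e a (s : M) :
  eval (Upd U e a) s =
  if insub (s, e) is Some x then @eval a (update M U) x else V1.
Proof.
rewrite /=; set v := fun x p => lookup _ _ _.
suff -> : v = fun x p => eval (post U x.2 p) x.1 by [].
apply/funext => x; apply/funext => p; rewrite /v /post.
by elim: (binds U x.2) => //= b l ->; case: ifP.
Qed.

Definition entails (G : set (form P N)) (a : form P N) : Prop :=
  forall (M : model) (s : M),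
    (forall g, G g -> designated (eval g s)) -> designated (eval a s).

Definition satisfiable (a : form P N) : Prop :=
  exists (M : model) (s : M), designated (eval a s).

(* A finite presentation of a Kripke model with states 'I_n.+1; at each state,
   variables that are not listed have value 0. *)
Record fmodel (n : nat) := FModel {
  fframe : frame N n;
  fval : 'I_n.+1 -> seq (P * tv) }.

Lemma frame_equiv n (F : frame N n) i : Equivalence (frel F i).
Proof.
have [r s t] := frel_equiv F i.
by split=> [x|x y|x y z]; [exact: r|rewrite s|exact: t].
Qed.

Definition model_of n (M : fmodel n) : model :=
  @Model 'I_n.+1 (fun i x y => frel (fframe M) i x y) (frame_equiv (fframe M))
    (fun s p => lookup V0 (fval M s) p).

End Semantics.

(** * Effectivity *)

(* Total recursive functions: the least class of functions nat^k -> nat that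
   contains zero, successor and the projections and is closed under
   composition, primitive recursion and minimization of regular functions. *)
Inductive recursive : forall k : nat, (k.-tuple nat -> nat) -> Prop :=
  | rec_zero k : recursive (fun _ : k.-tuple nat => 0)
  | rec_succ : recursive (fun v : 1.-tuple nat => (tnth v ord0).+1)
  | rec_proj k (i : 'I_k) : recursive (fun v : k.-tuple nat => tnth v i)
  | rec_comp k m (f : m.-tuple nat -> nat) (g : 'I_m -> k.-tuple nat -> nat) :
      recursive f -> (forall i, recursive (g i)) ->
      recursive (fun v : k.-tuple nat => f [tuple g i v | i < m])
  | rec_prim k (f : k.-tuple nat -> nat) (g : k.+2.-tuple nat -> nat)
      (h : k.+1.-tuple nat -> nat) :
      recursive f -> recursive g ->
      (forall v : k.-tuple nat, h [tuple of 0 :: v] = f v) ->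
      (forall x (v : k.-tuple nat), h [tuple of x.+1 :: v] =
         g [tuple of x :: h [tuple of x :: v] :: v]) ->
      recursive h
  | rec_min k (f : k.+1.-tuple nat -> nat) (h : k.-tuple nat -> nat) :
      recursive f ->
      (forall v : k.-tuple nat, f [tuple of h v :: v] = 0) ->
      (forall (v : k.-tuple nat) x, x < h v -> f [tuple of x :: v] <> 0) ->
      recursive h.

(* Goedel numberings, based on the bijection [CodeSeq.code] from seq nat to
   nat.  Variables and agents are numbered by their standard enumerations. *)
Section Coding.
Context (P : countType) (N : finType).

Local Notation code := CodeSeq.code.

Definition code_frame n (F : frame N n) : nat :=
  code [seq code [seq code [seq nat_of_bool (frel F i x y)
                            | y <- enum 'I_n.+1]
                  | x <- enum 'I_n.+1]
        | i <- enum N].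

Fixpoint code_form (a : form P N) : nat :=
  match a with
  | Var p => code [:: 0; pickle p]
  | Neg b => code [:: 1; code_form b]
  | Inc b => code [:: 2; code_form b]
  | And b c => code [:: 3; code_form b; code_form c]
  | Know i b => code [:: 4; nat_of_ord (enum_rank i); code_form b]
  | Upd n U e b =>
      code [:: 5; n; code_frame (uframe U);
        code [seq code_form (pre U f) | f <- enum 'I_n.+1];
        code [seq code [seq code [:: pickle c.1; code_form c.2]
                        | c <- binds U f]
              | f <- enum 'I_n.+1];
        nat_of_ord e; code_form b]
  end.

Definition code_tv (x : tv) : nat :=
  match x with V0 => 0 | Vh => 1 | V1 => 2 end.

Definition code_fmodel n (M : fmodel P N n) : nat :=
  code [:: n; code_frame (fframe M);
    code [seq code [seq code [:: pickle c.1; code_tv c.2] | c <- fval M s]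
          | s <- enum 'I_n.+1]].

(* d is an effective procedure that, given (the code of) a formula, returns a
   bit telling whether it is satisfiable, together with a finite model and a
   state where it is designated, respectively has value 0. *)
Definition decides_sat (d : 1.-tuple nat -> nat) : Prop :=
  recursive d /\
  forall a : form P N,
    exists (b : bool) (n : nat) (M : fmodel P N n) (s : 'I_n.+1),
      d [tuple code_form a] =
        code [:: nat_of_bool b; code_fmodel M; nat_of_ord s] /\
      if b then satisfiable a /\ designated (@eval P N a (model_of M) s)
      else ~ satisfiable a /\ @eval P N a (model_of M) s = V0.

End Coding.

(* Main.v *)
(** Soundness is an induction on derivations.  For strong completeness, the
    reduction axioms and RE turn every formula into a provably equivalent one
    without update operators.  Maximal theories avoiding a given formula carry
    a three-valued valuation that commutes with the connectives (1/2 when both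
    the formula and its negation belong to the theory), so that provable
    equivalence means equal values in all of them, and on update-free formulas
    the canonical model built on these theories evaluates each formula to this
    value.  Compactness follows because derivations are finite.

    For decidability, the value of a formula after a sequence of updates is
    computed in the original model: an item is a formula together with the
    sequence of updates to be executed before evaluating it.  The value of an
    item at a state is a function of the values, at the same state, of smaller
    items, except for [K_i]-items, whose value is the minimum over the
    [i]-class of a quantity (the body value) that each state determines by the
    values of smaller items.  A type assigns a value to each item in the
    finite closure of a formula, and the satisfiable types form the largest set
    of types that is locally correct and contains a witness for every value of
    a [K_i]-item, two types being related by [~_i] when they agree on the
    [K_i]-items.  Searching all sets of types is a recursive function. *)

Require Import Defs.
From Stdlib Require List.
From Stdlib Require Import RelationClasses.
From HB Require Import structures.
From mathcomp Require Import all_boot.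
From mathcomp Require Import boolp classical_sets cardinality zify.

Set Implicit Arguments.
Unset Strict Implicit.
Unset Printing Implicit Defensive.

Local Open Scope classical_set_scope.
(* [frel] alone is the relation of a function in the path library. *)
Local Notation frel := Defs.frel.
Local Notation code := CodeSeq.code.
Local Notation decode := CodeSeq.decode.

(** * Soundness *)

Section Values.
Context (P : countType) (N : finType).
Local Notation F := (form P N).
Implicit Types (a b c : F) (G : set F).

Lemma tinf_designated (A : set tv) :
  designated (tinf A) <-> forall x, A x -> designated x.
Proof.
rewrite /tinf; case: asboolP => [A0|A0].
  by split=> // /(_ _ A0).
by case: asboolP => Ah; split=> // _ [].
Qed.

(** A designated negation means a value below 1, and with only three values an infimum below 1 is
    attained. *)
Lemma tinf_neg_designated (A : set tv) :
  designated (tneg (tinf A)) <-> exists2 x, A x & designated (tneg x).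
Proof.
rewrite /tinf; case: asboolP => [A0|A0]; first by split=> // _; exists V0.
case: asboolP => [Ah|Ah]; first by split=> // _; exists Vh.
by split=> // -[[]].
Qed.

(** Designation alone does not separate 1/2 from 1; designation of the negation does. Equalities of
    values are therefore proved in two halves, in the same way as [Equ] consists of two [Iff]. *)
Lemma tv_eqP x y :
  designated x = designated y -> designated (tneg x) = designated (tneg y) ->
  x = y.
Proof. by case: x; case: y. Qed.

(** Both evaluation at a state and membership in a prime theory give such maps, so facts about the
    connectives are proved once for both. *)
Definition is_hom (w : F -> tv) :=
  [/\ forall a, w (Neg a) = tneg (w a), forall a, w (Inc a) = tinc (w a) &
      forall a b, w (And a b) = tmin (w a) (w b)].

Lemma eval_hom (M : model P N) (s : M) : is_hom (fun a => eval a s).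
Proof. by []. Qed.

Section Hom.
Context (w : F -> tv) (wH : is_hom w).
Local Notation d a := (designated (w a)).

Lemma homNeg a : w (Neg a) = tneg (w a). Proof. by case: wH. Qed.
Lemma homInc a : w (Inc a) = tinc (w a). Proof. by case: wH. Qed.
Lemma homAnd a b : w (And a b) = tmin (w a) (w b). Proof. by case: wH. Qed.
Definition homE := (homNeg, homInc, homAnd).

Lemma dAnd a b : d (And a b) = d a && d b.
Proof. by rewrite !homE; case: (w a); case: (w b). Qed.

Lemma dOr a b : d (Or a b) = d a || d b.
Proof. by rewrite !homE; case: (w a); case: (w b). Qed.

Lemma dImp a b : d (Imp a b) = (d a ==> d b).
Proof. by rewrite !homE; case: (w a); case: (w b). Qed.

Lemma dIff a b : d (Iff a b) = (d a == d b).
Proof. by rewrite dAnd !dImp; case: (d a); case: (d b). Qed.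

Lemma dEqu a b : d (Equ a b) <-> w a = w b.
Proof.
rewrite dAnd !dIff !homNeg; split=> [/andP[/eqP ? /eqP]|->]; first exact: tv_eqP.
by rewrite !eqxx.
Qed.

End Hom.

Section Eval.
Context (M : model P N).
Implicit Types s t : M.

Lemma dKnow i a s : designated (eval (Know i a) s) <->
  forall t, acc i s t -> designated (eval a t).
Proof.
rewrite [eval _ _]/=; rewrite tinf_designated.
by split=> [h t st|h _ [t st <-]]; [apply: h; exists t|exact: h].
Qed.

Lemma dNKnow i a s : designated (tneg (eval (Know i a) s)) <->
  exists2 t, acc i s t & designated (tneg (eval a t)).
Proof.
rewrite [eval _ _]/=; rewrite tinf_neg_designated.
by split=> [[_ [t st <-] h]|[t st h]]; [exists t|exists (eval a t) => //; exists t].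
Qed.

Lemma dPoss i a s : designated (eval (Poss i a) s) <->
  exists2 t, acc i s t & designated (eval a t).
Proof.
have -> : designated (eval (Poss i a) s) =
  designated (tneg (eval (Know i (Neg a)) s)) by [].
rewrite dNKnow; split=> -[t st h]; exists t => //; move: h => /=; by case: eval.
Qed.

End Eval.

(** The hypothesis ranges over all models because [Upd] evaluates its argument in another one; that
    model is unchanged by [repl], which leaves update models alone. *)
Lemma repl_eval t g (tg : forall (M : model P N) (s : M), eval t s = eval g s) a :
  forall (M : model P N) (s : M), eval (repl t g a) s = eval a s.
Proof.
elim: a => [p|b IH|b IH|b IHb c IHc|i b IH|n U e b IH] M s;
  rewrite [repl _ _ _]/=; case: asboolP => [->//|_] //=.
- by rewrite IH.
- by rewrite IH.
- by rewrite IHb IHc.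
- by congr tinf; apply/seteqP; split=> _ [x sx <-]; exists x => //; rewrite IH.
- by case: insub => [x|//]; rewrite IH.
Qed.

Lemma foldl_dAnd w (wH : is_hom w) a l :
  designated (w (foldl (@And P N) a l)) =
    designated (w a) && all (fun b => designated (w b)) l.
Proof. by elim: l a => [|b l IH] a /=; rewrite ?andbT// IH dAnd// andbA. Qed.

Lemma foldl_dNAnd w (wH : is_hom w) a l :
  designated (tneg (w (foldl (@And P N) a l))) =
    designated (tneg (w a)) || has (fun b => designated (tneg (w b))) l.
Proof.
elim: l a => [|b l IH] a /=; rewrite ?orbF// IH homAnd// orbA; congr orb.
by case: (w a); case: (w b).
Qed.

End Values.

(** * Validity of the axioms and rules *)

Section Soundness.
Context (P : countType) (N : finType).
Local Notation F := (form P N).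
Implicit Types (a b c : F) (G : set F) (M : model P N).

(** If the precondition is not designated, both sides are exactly 1; if it is, the implication has
    exactly the value of [b]. This reduces the guarded reduction axioms to a comparison at the state
    [(s, e)] of the update. *)
Lemma eval_guard M (s : M) n (U : umodel P N F n) e a b :
  (forall x : update M U, val x = (s, e) -> eval a x = eval b s) ->
  eval (Upd U e a) s = eval (Imp (pre U e) b) s.
Proof.
move=> h; rewrite eval_Upd; case: insubP => [x /= dx xE|/= nd].
  by rewrite h// /=; move: dx; case: (eval (pre _ _) _); case: (eval b s).
by rewrite /=; move: nd; case: (eval (pre _ _) _).
Qed.

Lemma eval_UpdE M (s : M) n (U : umodel P N F n) e a (x : update M U) :
  val x = (s, e) -> eval (Upd U e a) s = eval a x.
Proof. by move=> xE; rewrite eval_Upd -xE valK. Qed.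

Lemma KnowUpd_designated M (s : M) n (U : umodel P N F n) e i a :
  designated (eval (KnowUpd U e i a) s) <->
  forall f, frel (uframe U) i e f -> designated (eval (Know i (Upd U f a)) s).
Proof.
rewrite /KnowUpd (foldl_dAnd (eval_hom s)) all_map; split.
  move=> /andP[he /allP h] f ef; have [->//|fe] := eqVneq f e.
  by apply: h; rewrite mem_filter fe ef mem_enum.
move=> h; rewrite h; last by case: (frel_equiv (uframe U) i).
by apply/allP => f; rewrite mem_filter => /andP[/andP[_ /h]].
Qed.

Lemma KnowUpd_neg_designated M (s : M) n (U : umodel P N F n) e i a :
  designated (tneg (eval (KnowUpd U e i a) s)) <->
  exists2 f, frel (uframe U) i e f &
    designated (tneg (eval (Know i (Upd U f a)) s)).
Proof.
rewrite /KnowUpd (foldl_dNAnd (eval_hom s)) has_map; split.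
  case/orP => [h|/hasP[f]].
    by exists e => //; case: (frel_equiv (uframe U) i).
  by rewrite mem_filter => /andP[/andP[_ ef] _ h]; exists f.
case=> f ef h; have [<-|fe] := eqVneq f e; first by rewrite h.
by apply/orP; right; apply/hasP; exists f => //; rewrite mem_filter fe ef mem_enum.
Qed.

(** The states accessible from [(s, e)] are the executable pairs [(t, f)] with [t] accessible from
    [s] and [f] from [e]. At the other pairs [Upd U f a] has value 1, which does not affect an
    infimum. *)
Lemma eval_upd_know M (s : M) n (U : umodel P N F n) e i a
    (x : update M U) : val x = (s, e) ->
  eval (Know i a) x = eval (KnowUpd U e i a) s.
Proof.
move=> xE; apply: tv_eqP; apply/idP/idP.
- move=> /dKnow h; apply/KnowUpd_designated => f ef; apply/dKnow => t st.
  rewrite eval_Upd; case: insubP => [y _ yE|//]; apply: h.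
  by split; rewrite xE yE.
- move=> /KnowUpd_designated h; apply/dKnow => y [sy ey].
  rewrite xE in sy ey; have /dKnow /(_ _ sy) := h _ ey.
  by rewrite (@eval_UpdE _ _ _ _ _ _ y) -?surjective_pairing.
- move=> /dNKnow[y [sy ey] h]; apply/KnowUpd_neg_designated.
  rewrite xE in sy ey; exists (val y).2 => //.
  apply/dNKnow; exists (val y).1 => //.
  by rewrite (@eval_UpdE _ _ _ _ _ _ y) -?surjective_pairing.
- move=> /KnowUpd_neg_designated[f ef /dNKnow[t st]].
  rewrite eval_Upd; case: insubP => [y _ yE|//] h; apply/dNKnow; exists y => //.
  by split; rewrite xE yE.
Qed.

Lemma eImp M (s : M) a b : designated (eval (Imp a b) s) <->
  (designated (eval a s) -> designated (eval b s)).
Proof. by have -> := dImp (eval_hom s) a b; split=> /implyP. Qed.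

Lemma eOr M (s : M) a b : designated (eval (Or a b) s) <->
  (designated (eval a s) \/ designated (eval b s)).
Proof. by have -> := dOr (eval_hom s) a b; split=> /orP. Qed.

Lemma eEqu M (s : M) a b : designated (eval (Equ a b) s) <-> eval a s = eval b s.
Proof. exact: (dEqu (eval_hom s)). Qed.

Lemma evalNeg M (s : M) a : eval (Neg a) s = tneg (eval a s).
Proof. by []. Qed.

Lemma evalInc M (s : M) a : eval (Inc a) s = tinc (eval a s).
Proof. by []. Qed.

Lemma evalAnd M (s : M) a b : eval (And a b) s = tmin (eval a s) (eval b s).
Proof. by []. Qed.

Lemma hom_designated M (s : M) a :
  (forall w, is_hom w -> designated (w a)) -> designated (eval a s).
Proof. by move=> h; have := h _ (eval_hom s). Qed.

Lemma ax_sound a : ax a -> forall M (s : M), designated (eval a s).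
Proof.
case=> {a} [a b|a b c|a b|a b|a b|a b|a b|a b c|a b|a|a b|a|a|a b|a b|a b|
  i a b|i a b|i a b|i a b|i a|i a|i a|i a|i a|i a|n U e p|n U e a|n U e a|
  n U e a b|n U e i a] M s; have hs := eval_hom s.
(* The propositional axioms hold under every homomorphism, so truth tables settle them. *)
1-16: apply: (hom_designated s) => w wH;
  rewrite /Iff /Imp /Or /Defs.SNeg /Defs.Cons !(homE wH).
1-16: by repeat match goal with |- context [?v ?x] => is_var v; case: (v x) end.
1-10: have [R S T] := acc_equiv M i; apply/eImp.
- move=> /dKnow h; apply/eImp => /dKnow h'; apply/dKnow => t st.
  by have /eImp := h _ st; apply; exact: h'.
- move=> /dKnow h; apply/eImp => /dPoss[t st at_]; apply/dPoss; exists t => //.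
  by have /eImp := h _ st; apply.
- by move=> /dPoss[t st /eOr[h|h]]; apply/eOr; [left|right]; apply/dPoss; exists t.
- move=> /eImp h; apply/dKnow => t st; apply/eImp => at_.
  by have /dKnow : designated (eval (Know i b) s);
    [apply: h; apply/dPoss; exists t|exact].
- by move=> /dKnow; apply; exact: R.
- move=> /dKnow h; apply/dKnow => t st; apply/dKnow => u tu; apply: h.
  exact: T _ _ _ st tu.
- move=> /dPoss[t st h]; apply/dKnow => u su; apply/dPoss; exists t => //.
  exact: T _ _ _ (S _ _ su) st.
- by move=> h; apply/dPoss; exists s => //; exact: R.
- move=> /dPoss[t st /dPoss[u tu h]]; apply/dPoss; exists u => //.
  exact: T _ _ _ st tu.
- move=> /dPoss[t st /dKnow h]; apply/dKnow => u su; apply: h.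
  exact: T _ _ _ (S _ _ st) su.
- by apply/eEqu; apply: eval_guard => x xE; rewrite /= xE.
- apply/eEqu; apply: eval_guard => x xE.
  by rewrite evalNeg [RHS]evalNeg (eval_UpdE _ xE).
- apply/eEqu; apply: eval_guard => x xE.
  by rewrite evalInc [RHS]evalInc (eval_UpdE _ xE).
(* This axiom has no guard: without a successor state both sides are 1. *)
- by apply/eEqu; rewrite [RHS]evalAnd !eval_Upd; case: insub.
- by apply/eEqu; apply: eval_guard => x xE; exact: eval_upd_know.
Qed.

Theorem soundness G a : derives G a -> entails G a.
Proof.
elim=> {G a} [G a Ga M s|G a axa M s _|G a b _ IHa _ IHb M s h|G i a _ IH M s _|
  G t g a _ IH M s _].
- exact.
- exact: ax_sound.
- by have /eImp := IHb M s h; apply; exact: IHa.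
- by apply/dKnow => t _; apply: IH => ? [].
- apply/eEqu; rewrite (repl_eval (g := g))// => M' s'.
  by apply/eEqu; apply: IH => ? [].
Qed.
End Soundness.

(** * Strong completeness *)

Section Derivations.
Context (P : countType) (N : finType).
Local Notation F := (form P N).
Implicit Types (a b c x : F) (G D : set F).

Lemma derives_weaken G D a : G `<=` D -> derives G a -> derives D a.
Proof.
move=> + d; elim: d D => {G a} [G a Ga|G a axa|G a b _ IHa _ IHb|G i a da _|
  G t g a dt _] D GD.
- exact/d_hyp/GD.
- exact: d_ax.
- by apply: d_mp (IHa _ GD) (IHb _ GD).
- exact: d_nec.
- exact: d_re.
Qed.

Lemma derives_compact G a : derives G a ->
  exists l : seq F, (forall b, List.In b l -> G b) /\
    derives [set b | List.In b l] a.
Proof.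
elim=> {G a} [G a Ga|G a axa|G a b _ [l [lG la]] _ [m [mG mab]]|G i a da _|
  G t g a dt _].
- by exists [:: a]; split=> [b [<-//|[]]|]; apply: d_hyp; left.
- by exists [::]; split=> //; apply: d_ax.
- exists (l ++ m); split=> [c /(@List.in_app_or _ _ _ _)[/lG|/mG]//|].
  apply: (@d_mp _ _ _ a); [apply: derives_weaken la|apply: derives_weaken mab];
    by move=> c cl; apply: List.in_or_app; by [left|right].
- by exists [::]; split=> //; apply: d_nec.
- by exists [::]; split=> //; apply: d_re.
Qed.

Lemma derives_imp_const G a b : derives G b -> derives G (Imp a b).
Proof. by move=> db; apply: d_mp db _; apply/d_ax/A1. Qed.

Lemma derives_imp_refl G a : derives G (Imp a a).
Proof.
apply: (@d_mp _ _ _ (Imp a (Imp a a))); first exact/d_ax/A1.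
apply: (@d_mp _ _ _ (Imp a (Imp (Imp a a) a))); first exact/d_ax/A1.
exact/d_ax/A2.
Qed.

(** Necessitation and replacement have premises derived from [set0], so their conclusions hold over
    any hypotheses and A1 adds the antecedent. *)
Lemma deduction G a b : derives (a |` G) b -> derives G (Imp a b).
Proof.
move GE: (a |` G) => H d; elim: d GE => {H b} [H b Hb|H b axb|H b c _ IHb _ IHc|
  H i b db _|H t g b dt _] GE.
- move: Hb; rewrite -GE => -[->|Gb]; first exact: derives_imp_refl.
  exact/derives_imp_const/d_hyp.
- exact/derives_imp_const/d_ax.
- apply: d_mp (IHb GE) _; apply: d_mp (IHc GE) _; exact/d_ax/A2.
- exact/derives_imp_const/d_nec.
- exact/derives_imp_const/d_re.
Qed.

(** Maximality among the sets that do not derive [x]. A theory may contain a formula and its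
    negation without being trivial, so nontriviality is witnessed by one underivable formula. *)
Definition avoids x D :=
  ~ derives D x /\ forall a, ~ D a -> derives (a |` D) x.

Definition prime_theory D := exists x, avoids x D.

(** Zorn's lemma is applied to the sets [A] such that [G] together with [A] does not derive [x].
    Keeping [G] apart from [A] makes the empty chain harmless, its union being [set0]. *)
Lemma lindenbaum G x : ~ derives G x -> exists2 D, G `<=` D & avoids x D.
Proof.
move=> Gx.
have [A [Ax Amax]] : exists A, ~ derives (G `|` A) x /\
    forall B, A `<` B -> ~ ~ derives (G `|` B) x.
  apply: (@Zorn_bigcup _ (fun A => ~ derives (G `|` A) x)) => C Cx Ctot.
  move=> /derives_compact[l [lG lx]].
  (* The finitely many hypotheses of the derivation lie in [G] and a single member of the chain, or
     in [G] alone, which is the case [set0]. *)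
  suff [X [XC lX]] : exists X, (X = set0 \/ C X) /\
      forall b, List.In b l -> (G `|` X) b.
    have {}lx : derives (G `|` X) x by apply: derives_weaken lx.
    by case: XC lx => [->|/Cx//]; rewrite setU0.
  elim: l lG {lx} => [|b l IH] lG; first by exists set0; split=> //; left.
  have [|X [XC lX]] := IH; first by move=> c cl; apply: lG; right.
  have [Gb|[Y CY Yb]] := lG b (or_introl erefl).
    by exists X; split=> // c [<-|/lX//]; left.
  have [XY|YX] : X `<=` Y \/ Y `<=` X.
  - by case: XC => [->|CX]; [left|exact: Ctot].
  - exists Y; split; [by right|move=> c [<-|/lX[]]]; [by right|by left|].
    by move/XY; right.
  - exists X; split=> // c [<-|/lX//]; right; exact: YX.
exists (G `|` A); first by move=> ?; left.
split=> // a nGa; have := Amax (a |` A).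
rewrite setUCA => h; apply: contrapT; apply: h; split=> [b|sub]; first by right.
by apply: nGa; right; apply: sub; left.
Qed.

Section PrimeTheory.
Context D (Dp : prime_theory D).

Lemma prime_closed a : derives D a -> D a.
Proof.
case: Dp => x [Dx Dmax] da; apply: contrapT => /Dmax dx.
exact: Dx (d_mp da (deduction dx)).
Qed.

Lemma prime_ax a : ax a -> D a.
Proof. by move=> axa; apply/prime_closed/d_ax. Qed.

Lemma prime_thm a : derives set0 a -> D a.
Proof. by move=> da; apply: prime_closed; apply: derives_weaken da. Qed.

Lemma prime_mp a b : D (Imp a b) -> D a -> D b.
Proof. by move=> dab da; apply: prime_closed; apply: d_mp; apply: d_hyp;
  eassumption. Qed.

Lemma prime_or a b : D (Or a b) <-> D a \/ D b.
Proof.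
split; last by case; apply: prime_mp; apply: prime_ax; constructor.
move=> ab; apply: contrapT => /not_orP[na nb]; case: Dp => x [Dx Dmax].
have [ax bx] := (deduction (Dmax _ na), deduction (Dmax _ nb)).
apply: Dx; apply: d_mp (d_hyp ab) _; apply: d_mp bx _; apply: d_mp ax _.
exact/d_ax/A8.
Qed.

(** The converse rests on A9: by primeness either [a] or the implication belongs to [D]. *)
Lemma prime_imp a b : D (Imp a b) <-> (D a -> D b).
Proof.
split=> [|h]; first exact: prime_mp.
have /prime_or[/h Db|//] := prime_ax (A9 a b).
by apply: prime_mp Db; apply/prime_ax/A1.
Qed.

Lemma prime_and a b : D (And a b) <-> D a /\ D b.
Proof.
split=> [ab|[da db]].
  by split; apply: prime_mp ab; apply: prime_ax; constructor.
by apply: prime_mp db; apply: prime_mp da; apply/prime_ax/A3.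
Qed.

Lemma prime_iff a b : D (Iff a b) <-> (D a <-> D b).
Proof. by rewrite prime_and !prime_imp; split=> [[]|[]]. Qed.

Lemma prime_nontrivial : exists a, ~ D a.
Proof. by case: Dp => x [Dx _]; exists x => ?; apply/Dx/d_hyp. Qed.

Lemma prime_em a : D a \/ D (Neg a).
Proof. by apply/prime_or/prime_ax/A10. Qed.

Lemma prime_cons a : D (Defs.Cons a) -> D a -> D (Neg a) -> False.
Proof.
move=> ca da na; case: prime_nontrivial => b; apply.
by have /prime_imp/(_ ca)/prime_imp/(_ da)/prime_imp/(_ na) := prime_ax (A11 a b).
Qed.

Lemma prime_inc a : D (Inc a) <-> D a /\ D (Neg a).
Proof.
split=> [ia|[da na]].
  by apply/prime_and; apply: prime_mp ia; apply/prime_ax/A12.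
by have [//|/prime_cons/(_ da na)] := prime_em (Inc a).
Qed.

Definition theory_value a : tv :=
  if `[< D a >] then if `[< D (Neg a) >] then Vh else V1 else V0.

Lemma theory_value_designated a : designated (theory_value a) <-> D a.
Proof.
by rewrite /theory_value; case: asboolP => // h; split=> // _; case: asboolP.
Qed.

Lemma theory_value_neg a : designated (tneg (theory_value a)) <-> D (Neg a).
Proof.
rewrite /theory_value; case: asboolP => h; first by case: asboolP => ?; split.
by split=> // _; case: (prime_em a).
Qed.

(** By [tv_eqP] each connective needs a clause for membership and one for membership of the
    negation. The latter is A13 for [Neg], excluded middle with [prime_cons] for [Inc], and A15 for
    [And]. *)
Lemma theory_value_hom : is_hom theory_value.
Proof.
split=> [a|a|a b]; apply: tv_eqP; apply/idP/idP.
- by move=> /theory_value_designated/theory_value_neg.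
- by move=> /theory_value_neg/theory_value_designated.
- move=> /theory_value_neg; have /prime_iff -> := prime_ax (A13 a).
  by move/theory_value_designated; case: theory_value.
- move=> h; apply/theory_value_neg; have /prime_iff -> := prime_ax (A13 a).
  by apply/theory_value_designated; case: theory_value h.
- move=> /theory_value_designated/prime_inc[/theory_value_designated].
  by move=> + /theory_value_neg; case: theory_value.
- move=> h; apply/theory_value_designated/prime_inc.
  rewrite -theory_value_designated -theory_value_neg.
  by case: theory_value h.
- move=> /theory_value_neg ci.
  have : ~ D (Inc a) by move=> /[dup] /prime_inc[? ?] _; exact: prime_cons ci _ _.
  rewrite prime_inc -theory_value_designated -theory_value_neg.
  by case: theory_value => // h; case: h.
- move=> h; apply/theory_value_neg; have [|//] := prime_em (Inc a).
  rewrite prime_inc -theory_value_designated -theory_value_neg.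
  by case: theory_value h => // _ [].
- move=> /theory_value_designated/prime_and.
  by rewrite -!theory_value_designated => -[]; do 2!case: theory_value.
- move=> h; apply/theory_value_designated/prime_and.
  by rewrite -!theory_value_designated; move: h; do 2!case: theory_value.
- move=> /theory_value_neg; have /prime_iff -> := prime_ax (A15 a b).
  rewrite prime_or -!theory_value_neg.
  by do 2!case: theory_value => //; case.
- move=> h; apply/theory_value_neg; have /prime_iff -> := prime_ax (A15 a b).
  rewrite prime_or -!theory_value_neg; move: h.
  by do 2!case: theory_value => //; move=> _; (left+right).
Qed.

End PrimeTheory.

Lemma derives_prime G a : derives G a <->
  forall D, prime_theory D -> G `<=` D -> D a.
Proof.
split=> [da D Dp GD|h]; first by apply: prime_closed => //; apply: derives_weaken da.
apply: contrapT => /lindenbaum[D GD aD]; case: (aD) => nDa _; apply: nDa.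
by apply: d_hyp; apply: (h D) => //; exists a.
Qed.

Definition equiv a b := derives set0 (Equ a b).

(** This turns provable equivalence into equality of values, so that congruence under the
    propositional connectives needs no derivation. Only [Know] and [Upd] call for the rule RE. *)
Lemma equivP a b : equiv a b <->
  forall D, prime_theory D -> theory_value D a = theory_value D b.
Proof.
rewrite /equiv derives_prime; split=> h D Dp.
  by apply/(dEqu (theory_value_hom Dp))/theory_value_designated; apply: h.
move=> _; apply/theory_value_designated/(dEqu (theory_value_hom Dp)); exact: h.
Qed.

Lemma equiv_trans b a c : equiv a b -> equiv b c -> equiv a c.
Proof. by rewrite !equivP => ab bc D Dp; rewrite ab// bc. Qed.

Lemma equiv_refl a : equiv a a.
Proof. exact/equivP. Qed.

Lemma equiv_neg a b : equiv a b -> equiv (Neg a) (Neg b).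
Proof. by rewrite !equivP => h D Dp; rewrite !(homE (theory_value_hom Dp)) h. Qed.

Lemma equiv_inc a b : equiv a b -> equiv (Inc a) (Inc b).
Proof. by rewrite !equivP => h D Dp; rewrite !(homE (theory_value_hom Dp)) h. Qed.

Lemma equiv_and a a' b b' :
  equiv a a' -> equiv b b' -> equiv (And a b) (And a' b').
Proof.
by rewrite !equivP => h h' D Dp; rewrite !(homE (theory_value_hom Dp)) h// h'.
Qed.

Lemma equiv_imp a a' b b' :
  equiv a a' -> equiv b b' -> equiv (Imp a b) (Imp a' b').
Proof.
move=> aa' bb'; apply/equiv_neg/equiv_and/equiv_neg => //; apply: equiv_neg.
by apply: equiv_and; [exact: equiv_neg|exact/equiv_neg/equiv_inc].
Qed.

Lemma repl_self a b : repl a b a = b.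
Proof. by case: a => [p|a|a|a a'|i a|n U e a] /=; case: asboolP. Qed.

Fixpoint form_size a : nat :=
  match a with
  | Var _ => 0
  | Neg b | Inc b | Know _ b | Upd _ _ _ b => (form_size b).+1
  | And b c => (form_size b + form_size c).+1
  end.

(** RE is applied to [Know i a] itself. As [repl] first compares the whole formula with [a], the
    case that they coincide has to be excluded, which [form_size] does. *)
Lemma equiv_know i a b : equiv a b -> equiv (Know i a) (Know i b).
Proof.
move=> ab; have := d_re set0 (Know i a) ab; rewrite [repl _ _ _]/=.
case: asboolP => [/(congr1 form_size)/= /eqP|_]; last by rewrite repl_self.
by rewrite -[X in _ == X]addn0 -addn1 eqn_add2l.
Qed.

Lemma equiv_upd n (U : umodel P N F n) e a b :
  equiv a b -> equiv (Upd U e a) (Upd U e b).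
Proof.
move=> ab; have := d_re set0 (Upd U e a) ab; rewrite [repl _ _ _]/=.
case: asboolP => [/(congr1 form_size)/= /eqP|_]; last by rewrite repl_self.
by rewrite -[X in _ == X]addn0 -addn1 eqn_add2l.
Qed.

Fixpoint static a : bool :=
  match a with
  | Var _ => true
  | Neg b | Inc b | Know _ b => static b
  | And b c => static b && static c
  | Upd _ _ _ _ => false
  end.

Definition reducible a := exists2 a', static a' & equiv a a'.

Lemma reducible_equiv a b : equiv a b -> reducible b -> reducible a.
Proof. by move=> ab [c sc bc]; exists c => //; apply: equiv_trans bc. Qed.

Lemma reducible_static a : static a -> reducible a.
Proof. by exists a => //; exact: equiv_refl. Qed.

Lemma reducible_neg a : reducible a -> reducible (Neg a).
Proof. by case=> a' ? ?; exists (Neg a') => //; exact: equiv_neg. Qed.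

Lemma reducible_inc a : reducible a -> reducible (Inc a).
Proof. by case=> a' ? ?; exists (Inc a') => //; exact: equiv_inc. Qed.

Lemma reducible_and a b : reducible a -> reducible b -> reducible (And a b).
Proof.
case=> a' sa ? [b' sb ?]; exists (And a' b'); first by rewrite /= sa.
exact: equiv_and.
Qed.

Lemma reducible_imp a b : reducible a -> reducible b -> reducible (Imp a b).
Proof.
case=> a' sa ? [b' sb ?]; exists (Imp a' b'); first by rewrite /= sa sb.
exact: equiv_imp.
Qed.

Lemma reducible_know i a : reducible a -> reducible (Know i a).
Proof. by case=> a' ? ?; exists (Know i a') => //; exact: equiv_know. Qed.

(** The reduction axioms push the operator inwards until it meets the variables, where reducible
    preconditions and postconditions remain. The action is quantified inside the induction because
    AM5 passes to other actions. *)
Lemma reducible_upd n (U : umodel P N F n) a :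
  (forall f, reducible (pre U f)) -> (forall f p, reducible (post U f p)) ->
  static a -> forall e, reducible (Upd U e a).
Proof.
move=> rpre rpost; elim: a => //= [p _|b IH sb|b IH sb|b IHb c IHc /andP[sb sc]|
  i b IH sb] e.
- apply: reducible_equiv (d_ax _ (UM1 U e p)) _; exact: reducible_imp.
- apply: reducible_equiv (d_ax _ (AM2 U e b)) _.
  by apply: reducible_imp => //; apply/reducible_neg/IH.
- apply: reducible_equiv (d_ax _ (AM3 U e b)) _.
  by apply: reducible_imp => //; apply/reducible_inc/IH.
- apply: reducible_equiv (d_ax _ (AM4 U e b c)) _.
  by apply: reducible_and; [exact: IHb|exact: IHc].
- apply: reducible_equiv (d_ax _ (AM5 U e i b)) _; apply: reducible_imp => //.
  rewrite /KnowUpd; have : reducible (Know i (Upd U e b)).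
    exact/reducible_know/IH.
  elim: [seq _ <- _ | _] (Know _ _) => //= f l IHl c rc; apply: IHl.
  exact/reducible_and/reducible_know/IH.
Qed.

Section FormInd.
Context (Q : F -> Prop).
Context (QVar : forall p, Q (Var N p)).
Context (QNeg : forall a, Q a -> Q (Neg a)).
Context (QInc : forall a, Q a -> Q (Inc a)).
Context (QAnd : forall a b, Q a -> Q b -> Q (And a b)).
Context (QKnow : forall i a, Q a -> Q (Know i a)).
Context (QUpd : forall n (U : umodel P N F n) e a,
  (forall f, Q (pre U f)) -> (forall f (d : P * F), List.In d (binds U f) -> Q d.2) ->
  Q a -> Q (Upd U e a)).

(** The generated induction principle gives no hypothesis for the formulas inside an update model.
    The inner [loop] over the bindings makes the recursive calls on them visibly structural. *)
Fixpoint form_nested_ind a : Q a :=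
  match a with
  | Var p => QVar p
  | Neg b => QNeg (form_nested_ind b)
  | Inc b => QInc (form_nested_ind b)
  | And b c => QAnd (form_nested_ind b) (form_nested_ind c)
  | Know i b => QKnow i (form_nested_ind b)
  | Upd n U e b =>
      match U return forall e, Q (Upd U e b) with
      | UModel fr pr bi => fun e => QUpd (U := UModel fr pr bi) e
        (fun f => form_nested_ind (pr f))
        (fun f => (fix loop (l : seq (P * F)) : forall d : P * F, List.In d l ->
          Q d.2 :=
           match l return forall d : P * F, List.In d l -> Q d.2 with
           | [::] => fun _ (h : False) => match h with end
           | d :: l' => fun d' h =>
              match h with
              | or_introl dd' =>
                  eq_ind d (fun d => Q d.2) (form_nested_ind d.2) d' dd'
              | or_intror h' => loop l' d' h'
              end
           end) (bi f))
        (form_nested_ind b)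
      end e
  end.
End FormInd.

Lemma lookup_ind (T : Type) (Q : T -> Prop) d (l : seq (P * T)) p :
  Q d -> (forall d' : P * T, List.In d' l -> Q d'.2) -> Q (lookup d l p).
Proof.
move=> Qd; elim: l => //= c l IH h; case: ifP => _; first by apply: h; left.
by apply: IH => c' ?; apply: h; right.
Qed.

(** Updates are eliminated from the inside: the argument is first made static by congruence, and
    then the outer operator is pushed through it. *)
Theorem reduction a : reducible a.
Proof.
elim/form_nested_ind: a => [p|a|a|a b ra rb|i a|n U e a rpre rpost [a' sa' aa']].
- exact: reducible_static.
- exact: reducible_neg.
- exact: reducible_inc.
- exact: reducible_and.
- exact: reducible_know.
- apply: reducible_equiv (equiv_upd U e aa') _.
  apply: reducible_upd => // f p; apply: lookup_ind => [|c /rpost//].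
  exact: reducible_static.
Qed.

End Derivations.

(** * The canonical model, completeness and compactness *)

Section Completeness.
Context (P : countType) (N : finType).
Local Notation F := (form P N).
Implicit Types (a b c x : F) (G D : set F).

Definition theory_rel (i : N) D D' := forall a, D (Know i a) <-> D' (Know i a).

(** For the converse inclusion, suppose [Know i a] is in [D'] but not in [D]. By 5' its possibility
    is not in [D] either, so K3 puts [Know i (Imp (Know i a) b)] into [D] for every [b]. Then [D']
    contains every [b], which is impossible. *)
Lemma theory_rel_sub D D' i : prime_theory D -> prime_theory D' ->
  (forall a, D (Know i a) -> D' a) -> theory_rel i D D'.
Proof.
move=> Dp Dp' h a; split=> [Ka|Ka].
  by apply: h; exact: (prime_mp Dp (prime_ax Dp (Ax4 _ _)) Ka).
apply: contrapT => nKa; have [b nb] := prime_nontrivial Dp'; apply: nb.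
have /h/(prime_imp Dp') : D (Know i (Imp (Know i a) b)); last exact.
apply: (prime_mp Dp (prime_ax Dp (AxK3 _ _ _))); apply/(prime_imp Dp) => PKa.
by case: nKa; exact: (prime_mp Dp (prime_ax Dp (Ax5' _ _)) PKa).
Qed.

(* K_i distributes over a chain of implications, hence over a derivation. *)
Lemma derives_know D i b : prime_theory D ->
  derives [set a | D (Know i a)] b -> D (Know i b).
Proof.
move=> Dp /derives_compact[l []]; elim: l b => [|a l IH] b lD lb.
  by apply: prime_thm => //; apply: d_nec; apply: derives_weaken lb => ? [].
have Ka : D (Know i a) by apply: lD; left.
have /(prime_mp Dp (prime_ax Dp (AxK _ _ _))) : D (Know i (Imp a b)).
  apply: IH => [c cl|]; first by apply: lD; right.
  by apply: deduction; apply: derives_weaken lb => c [<-|?]; [left|right].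
by move/(prime_imp Dp); exact.
Qed.

Lemma know_witness D i b : prime_theory D -> ~ D (Know i b) ->
  exists2 D', prime_theory D' & theory_rel i D D' /\ ~ D' b.
Proof.
move=> Dp nKb; have /lindenbaum[D' sub aD'] : ~ derives [set a | D (Know i a)] b.
  by move/(derives_know Dp).
have Dp' : prime_theory D' by exists b.
exists D' => //; split; first exact: theory_rel_sub.
by case: aD' => nb _ ?; apply/nb/d_hyp.
Qed.

(** A bottom formula: a plain contradiction may belong to a prime theory, a contradiction declared
    consistent may not. *)
Definition absurd a : F := And (Defs.Cons a) (And a (Neg a)).

Lemma prime_absurd D a : prime_theory D -> ~ D (absurd a).
Proof. by move=> Dp /(prime_and Dp)[c /(prime_and Dp)[? ?]];
  exact: prime_cons c _ _. Qed.

(** Both [absurd a] and [Know i (absurd a)] have value 0 in all prime theories, so they are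
    interchangeable below [Poss]; then 5' and T lead back to [absurd a]. *)
Lemma prime_poss_absurd D i a : prime_theory D -> ~ D (Poss i (absurd a)).
Proof.
move=> Dp; have absK : equiv (absurd a) (Know i (absurd a)).
  apply/equivP => D' Dp'; have na := prime_absurd (a := a) Dp'.
  have nKa : ~ D' (Know i (absurd a)).
    by move=> Ka; apply: na; exact: (prime_mp Dp' (prime_ax Dp' (AxT _ _)) Ka).
  by rewrite /theory_value; case: asboolP => // _; case: asboolP.
have /equivP/(_ _ Dp) : equiv (Poss i (absurd a)) (Poss i (Know i (absurd a))).
  exact/equiv_neg/equiv_know/equiv_neg.
move=> E /theory_value_designated; rewrite E => /theory_value_designated.
move/(prime_mp Dp (prime_ax Dp (Ax5' _ _)))/(prime_mp Dp (prime_ax Dp (AxT _ _))).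
exact: prime_absurd.
Qed.

Lemma prime_neg_know D i b : prime_theory D ->
  D (Neg (Know i b)) <-> D (Poss i (Neg b)).
Proof.
move=> Dp; rewrite -!theory_value_designated.
suff /equivP E : equiv (Neg (Know i b)) (Poss i (Neg b)) by rewrite E.
apply: equiv_neg; apply: equiv_know; apply/equivP => D' Dp';
  rewrite !(homE (theory_value_hom Dp')).
by case: theory_value.
Qed.

(** This does not follow from [know_witness], since a theory may contain both [Know i b] and its
    negation. The witness extends [c] and the known formulas while avoiding [absurd c]; K1 shows
    that this is possible. *)
Lemma poss_witness D i c : prime_theory D ->
  D (Poss i c) <-> exists2 D', prime_theory D' & theory_rel i D D' /\ D' c.
Proof.
move=> Dp; split=> [Pc|[D' Dp' [DD' D'c]]].
  have /lindenbaum[D' sub aD'] : ~ derives (c |` [set a | D (Know i a)]) (absurd c).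
    move=> /deduction/(derives_know Dp).
    move/(prime_mp Dp (prime_ax Dp (AxK1 _ _ _))) => /(prime_imp Dp)/(_ Pc).
    exact: prime_poss_absurd.
  have Dp' : prime_theory D' by exists (absurd c).
  exists D' => //; split; last by apply: sub; left.
  by apply: theory_rel_sub => // a ?; apply: sub; right.
have : D' (Know i (Poss i c)).
  apply: (prime_mp Dp' (prime_ax Dp' (Ax5 _ _))).
  exact: (prime_mp Dp' (prime_ax Dp' (AxT' _ _))).
by move/DD'/(prime_mp Dp (prime_ax Dp (AxT _ _))).
Qed.

Lemma theory_rel_equiv i :
  Equivalence (fun s t : {D | prime_theory D} => theory_rel i (sval s) (sval t)).
Proof.
split=> [D a//|D D' h a|D D' D'' h h' a]; first by rewrite (h a).
by rewrite (h a) (h' a).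
Qed.

Definition canonical : model P N :=
  Model theory_rel_equiv (fun s p => theory_value (sval s) (Var N p)).

(** In the case of [Know], the half of [tv_eqP] about designation uses [know_witness] and the half
    about the negation uses [poss_witness]. *)
Lemma canonical_truth a (D : canonical) : static a ->
  eval a D = theory_value (sval D) a.
Proof.
elim: a D => [p|a IH|a IH|a IHa b IHb|i a IH|//] D;
  have hD := theory_value_hom (proj2_sig D).
- by [].
- by move=> sa; rewrite evalNeg homE// IH.
- by move=> sa; rewrite evalInc (homInc hD) IH.
- by case/andP=> sa sb; rewrite evalAnd (homAnd hD) IHa// IHb.
move=> sa; have {}sa : static a := sa; have Dp := proj2_sig D.
apply: tv_eqP; apply/idP/idP.
- move=> /dKnow K; apply/theory_value_designated;
  apply: contrapT => /(know_witness Dp)[D' Dp'].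
  move=> [DD']; apply; have := K (exist _ D' Dp') DD';
    rewrite IH// => /theory_value_designated; exact.
- move=> /theory_value_designated Ka; apply/dKnow => D' DD'; rewrite IH//;
  apply/theory_value_designated.
  have Dp' := proj2_sig D'; apply: (prime_mp Dp' (prime_ax Dp' (AxT i _))).
  by apply/DD'/Ka.
- move=> /dNKnow[D' DD']; rewrite IH// => /(theory_value_neg (proj2_sig D')) na.
  apply/(theory_value_neg Dp)/(prime_neg_know _ _ Dp)/(poss_witness _ _ Dp).
  by exists (sval D') => //; exact: (proj2_sig D').
- move=> /(theory_value_neg Dp)/(prime_neg_know _ _ Dp)/(poss_witness _ _ Dp).
  case=> D' Dp' [DD' na]; apply/dNKnow; exists (exist _ D' Dp') => //.
  by rewrite IH//; apply/(theory_value_neg Dp').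
Qed.

Theorem completeness G a : entails G a -> derives G a.
Proof.
move=> Ga; apply/derives_prime => D Dp GD.
(* The truth lemma reaches all formulas through a static equivalent: soundness preserves the
   semantic value, [equivP] the value in the theory. *)
have val_eq b : eval b (exist _ D Dp : canonical) = theory_value D b.
  have [b' sb' bb'] := reduction b.
  have /eEqu -> : designated (eval (Equ b b') (exist _ D Dp : canonical)).
    by apply: soundness bb' _ _ _ => ? [].
  by rewrite canonical_truth//; move/equivP: bb' => ->.
apply/theory_value_designated; rewrite -val_eq; apply: Ga => g Gg.
by rewrite val_eq; apply/theory_value_designated/GD.
Qed.

Theorem compactness G a : entails G a -> exists G' : set F,
  [/\ finite_set G', G' `<=` G & entails G' a].
Proof.
move/completeness/derives_compact => [l [lG la]].
exists [set b | List.In b l]; split=> //; last exact: soundness.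
elim: l {lG la} => [|b l IH]; first exact: finite_set0.
have -> : [set c | List.In c (b :: l)] = b |` [set c | List.In c l].
  by apply/seteqP; split=> c [->|?]; by [left|right].
by rewrite finite_setU.
Qed.

End Completeness.

(** * Recursive functions on coded data *)

Section Recursive.

Lemma recursive_ext k (f g : k.-tuple nat -> nat) :
  f =1 g -> recursive f -> recursive g.
Proof. by move=> /funext ->. Qed.

Definition recursive1 (f : nat -> nat) := recursive (fun v : 1.-tuple nat =>
  f (tnth v ord0)).
Definition recursive2 (f : nat -> nat -> nat) :=
  recursive (fun v : 2.-tuple nat => f (tnth v ord0) (tnth v (inord 1))).

Lemma recursive_comp1 k f (A : k.-tuple nat -> nat) :
  recursive1 f -> recursive A -> recursive (fun v => f (A v)).
Proof.
move=> rf rA; apply: recursive_ext (rec_comp rf (g := fun=> A) (fun=> rA)) => v.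
by rewrite tnth_mktuple.
Qed.

Lemma recursive_comp2 k f (A B : k.-tuple nat -> nat) :
  recursive2 f -> recursive A -> recursive B -> recursive (fun v => f (A v) (B v)).
Proof.
move=> rf rA rB.
apply: recursive_ext (rec_comp rf (g := fun i => if i == ord0 then A else B) _) =>
  [v|i].
  by rewrite !tnth_mktuple /=; congr f; rewrite -val_eqE /= inordK.
by case: ifP.
Qed.

Lemma recursive_const k n : recursive (fun _ : k.-tuple nat => n).
Proof.
elim: n => [|n IH]; first exact: rec_zero.
exact: recursive_comp1 rec_succ IH.
Qed.

Lemma recursive_succ k (A : k.-tuple nat -> nat) :
  recursive A -> recursive (fun v => (A v).+1).
Proof. exact: recursive_comp1 rec_succ. Qed.

Lemma recursive2_prim (f : nat -> nat) (g : nat -> nat -> nat -> nat)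
    (h : nat -> nat -> nat) :
  recursive1 f ->
  recursive (fun v : 3.-tuple nat =>
    g (tnth v ord0) (tnth v (inord 1)) (tnth v (inord 2))) ->
  (forall y, h 0 y = f y) -> (forall x y, h x.+1 y = g x (h x y) y) ->
  recursive2 h.
Proof.
move=> rf rg h0 hS.
have H := @rec_prim 1 _ _ (fun v => h (tnth v ord0) (tnth v (inord 1))) rf rg.
apply: H => [v|x v]; rewrite !(tnth_nth 0) /= ?inordK //= ?h0 ?hS.
Qed.

Lemma recursive_swap h : recursive2 h -> recursive2 (fun x y => h y x).
Proof. by move=> rh; apply: recursive_comp2 rh _ _; exact: rec_proj. Qed.

Lemma recursive2_iter f : recursive1 f -> recursive2 (fun n x => iter n f x).
Proof.
move=> rf; apply: (recursive2_prim (f := id) (g := fun _ r _ => f r)) => //.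
  exact: rec_proj.
by apply: recursive_comp1 rf _; exact: rec_proj.
Qed.

Lemma recursive1_comp f g : recursive1 f -> recursive1 g -> recursive1 (fun x =>
  f (g x)).
Proof. by move=> rf rg; apply: recursive_comp1 rf rg. Qed.

Lemma recursive1_comp2 f g h :
  recursive2 f -> recursive1 g -> recursive1 h -> recursive1 (fun x => f (g x) (h x)).
Proof. by move=> rf rg rh; apply: recursive_comp2 rf rg rh. Qed.

Lemma recursive1_const n : recursive1 (fun=> n).
Proof. exact: recursive_const. Qed.

Lemma recursive1_id : recursive1 id.
Proof. exact: rec_proj. Qed.

Lemma recursive1_prim n0 (g : nat -> nat -> nat) h : recursive2 g ->
  h 0 = n0 -> (forall x, h x.+1 = g x (h x)) -> recursive1 h.
Proof.
move=> rg h0 hS.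
have rh : recursive2 (fun x _ => h x).
  apply: (@recursive2_prim (fun=> n0) (fun x r _ => g x r)) => //.
    exact: recursive1_const.
  by apply: recursive_comp2 rg _ _; exact: rec_proj.
exact: recursive1_comp2 rh recursive1_id recursive1_id.
Qed.

(** A case distinction is a primitive recursion that discards the previous value. *)
Lemma recursive1_if (f g h : nat -> nat) : recursive1 f -> recursive1 g ->
  recursive1 h ->
  recursive1 (fun x => if f x == 0 then g x else h x).
Proof.
move=> rf rg rh; pose c x y := if x == 0 then g y else h y.
suff rc : recursive2 c by exact: recursive1_comp2 rc rf recursive1_id.
apply: (@recursive2_prim g (fun _ _ y => h y)) => //.
by apply: recursive_comp1 rh _; exact: rec_proj.
Qed.

Lemma recursive2_add : recursive2 addn.
Proof.
apply: (@recursive2_prim id (fun _ r _ => r.+1)) => //; first exact: rec_proj.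
by apply: recursive_succ; exact: rec_proj.
Qed.

Lemma recursive2_mul : recursive2 muln.
Proof.
apply: (@recursive2_prim (fun=> 0) (fun _ r y => y + r)) => //.
  exact: recursive1_const.
by apply: recursive_comp2 recursive2_add _ _; exact: rec_proj.
Qed.

Lemma recursive1_pred : recursive1 predn.
Proof. by apply: (@recursive1_prim 0 (fun x _ => x)) => //; exact: rec_proj. Qed.

Lemma recursive2_sub : recursive2 subn.
Proof.
(* Recursion runs on the first argument, whereas subtraction recurses on the second. *)
apply: (@recursive_swap (fun x y => y - x)).
apply: (@recursive2_prim id (fun _ r _ => r.-1)).
- exact: rec_proj.
- by apply: recursive_comp1 recursive1_pred _; exact: rec_proj.
- by move=> y; rewrite subn0.
- by move=> x y; rewrite subnS.
Qed.

Lemma recursive1_exp2 : recursive1 (expn 2).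
Proof.
apply: (@recursive1_prim 1 (fun _ r => r + r)) => // [|x].
  by apply: recursive_comp2 recursive2_add _ _; exact: rec_proj.
by rewrite expnS mul2n addnn.
Qed.

Lemma recursive1_odd : recursive1 (fun x => nat_of_bool (odd x)).
Proof.
apply: (@recursive1_prim 0 (fun _ r => 1 - r)) => // [|x /=].
  by apply: recursive_comp2 recursive2_sub _ _;
    [exact: recursive_const|exact: rec_proj].
by case: (odd x).
Qed.

Lemma recursive1_half : recursive1 half.
Proof.
apply: (@recursive1_prim 0 (fun x r => odd x + r)) => // [|x].
  apply: recursive_comp2 recursive2_add _ _; last exact: rec_proj.
  by apply: recursive_comp1 recursive1_odd _; exact: rec_proj.
by rewrite /= uphalf_half.
Qed.

End Recursive.

(* 2 ^ a * (2 b + 1) codes the pair (a, b), so that [code] sends cons to [ncons]. *)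
Definition ncons a b := 2 ^ a * (b.*2.+1).
(** Iterating this map strips the factors 2 and then stays at the odd part. As the exponent is below
    the number, [n] rounds suffice, and the number of even intermediate values is the exponent. *)
Definition halve_even n := if odd n then n else n./2.
Definition odd_part n := iter n halve_even n.
Definition ntl n := (odd_part n)./2.
Fixpoint nhd_upto k n :=
  if k is k'.+1 then ~~ odd (iter k' halve_even n) + nhd_upto k' n else 0.
Definition nhd n := if n == 0 then 0 else nhd_upto n n.

Lemma code_cons x s : code (x :: s) = ncons x (code s).
Proof. by []. Qed.

Lemma ncons_gt0 a b : 0 < ncons a b.
Proof. by rewrite muln_gt0 expn_gt0. Qed.

Lemma iter_halve_even a b k : iter k halve_even (ncons a b) = ncons (a - k) b.
Proof.
elim: k => [|k IH]; first by rewrite subn0.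
rewrite iterS {}IH subnS; case: (a - k) => [|c].
  by rewrite /halve_even /ncons mul1n /= odd_double.
by rewrite /halve_even /ncons expnS -mulnA mul2n odd_double doubleK.
Qed.

Lemma ncons_gt a b : a < ncons a b.
Proof. by apply: leq_trans (ltn_expl a (ltnSn 1)) _; rewrite leq_pmulr. Qed.

Lemma ntlK a b : ntl (ncons a b) = b.
Proof.
rewrite /ntl /odd_part iter_halve_even; have /eqP -> : a - ncons a b == 0.
  by rewrite subn_eq0 ltnW// ncons_gt.
by rewrite /ncons mul1n /= uphalf_double.
Qed.

Lemma odd_ncons a b : odd (ncons a b) = (a == 0).
Proof.
case: a => [|a]; rewrite /ncons ?mul1n /= ?odd_double//.
by rewrite expnS -mulnA mul2n odd_double.
Qed.

Lemma nhdK a b : nhd (ncons a b) = a.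
Proof.
rewrite /nhd (gtn_eqF (ncons_gt0 a b)).
suff -> k : nhd_upto k (ncons a b) = minn a k by apply/minn_idPl/ltnW/ncons_gt.
elim: k => [|k /= ->]; first by rewrite minn0.
rewrite iter_halve_even odd_ncons subn_eq0 -ltnNge.
by case: (ltnP k a) => h /=; lia.
Qed.

Lemma recursive2_ncons : recursive2 ncons.
Proof.
apply: recursive_comp2 recursive2_mul _ _.
  by apply: recursive_comp1 recursive1_exp2 _; exact: rec_proj.
apply/recursive_succ; apply: (@recursive_ext _
  (fun v : 2.-tuple nat => tnth v (inord 1) + tnth v (inord 1))) => [v|].
  by rewrite addnn.
by apply: recursive_comp2 recursive2_add _ _; exact: rec_proj.
Qed.

Lemma recursive1_halve_even : recursive1 halve_even.
Proof.
have := recursive1_if recursive1_odd recursive1_half recursive1_id.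
apply: recursive_ext => v; rewrite /halve_even; by case: odd.
Qed.

Lemma recursive1_ntl : recursive1 ntl.
Proof.
apply: recursive1_comp recursive1_half _.
exact: recursive1_comp2 (recursive2_iter recursive1_halve_even) recursive1_id
  recursive1_id.
Qed.

Lemma recursive1_nhd : recursive1 nhd.
Proof.
apply: recursive1_if recursive1_id (recursive1_const 0) _.
apply: recursive1_comp2 recursive1_id recursive1_id.
apply: (@recursive2_prim (fun=> 0)
  (fun x r y => (1 - odd (iter x halve_even y)) + r)) => //.
- exact: recursive1_const.
- apply: recursive_comp2 recursive2_add _ _; last exact: rec_proj.
  apply: recursive_comp2 recursive2_sub _ _; first exact: recursive_const.
  apply: recursive_comp1 recursive1_odd _.
  by apply: recursive_comp2 (recursive2_iter recursive1_halve_even) _ _;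
    exact: rec_proj.
- by move=> x y /=; case: odd.
Qed.

(** * Encoded types and a calculus of computable functions *)

Definition tv_of_nat n := if n is n'.+1 then if n' is 0 then Vh else V1 else V0.

Lemma code_tvK : cancel code_tv tv_of_nat. Proof. by case. Qed.

HB.instance Definition _ := Equality.copy tv (can_type code_tvK).

Class Enc (T : Type) := { enc : T -> nat; enc_inj : injective enc }.

#[export] Instance Enc_nat : Enc nat := {| enc := id; enc_inj := @inj_id nat |}.

Lemma nat_of_bool_inj : injective nat_of_bool.
Proof. by case; case. Qed.

#[export] Instance Enc_bool : Enc bool := {| enc_inj := nat_of_bool_inj |}.

#[export] Instance Enc_tv : Enc tv := {| enc_inj := can_inj code_tvK |}.

Lemma enc_pair_inj T1 T2 (e1 : Enc T1) (e2 : Enc T2) :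
  injective (fun x : T1 * T2 => ncons (enc x.1) (enc x.2)).
Proof.
move=> [a b] [c d] /= h; have := congr1 nhd h; have := congr1 ntl h.
by rewrite !nhdK !ntlK => bd ac; congr pair; exact: enc_inj.
Qed.

#[export] Instance Enc_pair T1 T2 (e1 : Enc T1) (e2 : Enc T2) : Enc (T1 * T2) :=
  {| enc_inj := @enc_pair_inj T1 T2 e1 e2 |}.

Lemma enc_seq_inj T (e : Enc T) : injective (fun s : seq T => code (map enc s)).
Proof.
by move=> s t /(can_inj CodeSeq.codeK); apply: inj_map; exact: enc_inj.
Qed.

#[export] Instance Enc_seq T (e : Enc T) : Enc (seq T) := {| enc_inj :=
  @enc_seq_inj T e |}.

(* f is computed on codes by a recursive function.  The domain E serves as an
   environment: an open term with variables in E is a function on E, and a term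
   under a binder is a function on the pairs of the bound value and E. *)
Definition comp E T {eE : Enc E} {eT : Enc T} (f : E -> T) :=
  exists2 g, recursive1 g & forall e, g (enc e) = enc (f e).

Lemma enc_cons T {eT : Enc T} (x : T) s : enc (x :: s) = ncons (enc x) (enc s).
Proof. by []. Qed.

Lemma enc_seq_nat (s : seq nat) : enc s = code s.
Proof. by rewrite /= map_id. Qed.

Lemma recursive1_eqn f g : recursive1 f -> recursive1 g ->
  recursive1 (fun x => nat_of_bool (f x == g x)).
Proof.
move=> rf rg.
have r2 := recursive1_if (recursive1_comp2 recursive2_sub rg rf)
  (recursive1_const 1) (recursive1_const 0).
have r1 := recursive1_if (recursive1_comp2 recursive2_sub rf rg) r2
  (recursive1_const 0).
apply: recursive_ext r1 => v; rewrite !subn_eq0 eqn_leq.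
by case: (_ <= _); case: (_ <= _).
Qed.

Section Comp.
Context (E : Type) {eE : Enc E}.

Lemma comp_ext T {eT : Enc T} (f g : E -> T) : f =1 g -> comp g -> comp f.
Proof. by move=> fg [h rh hg]; exists h => // e; rewrite hg fg. Qed.

Lemma comp_const T {eT : Enc T} (x : T) : comp (fun _ : E => x).
Proof. by exists (fun=> enc x) => //; exact: recursive1_const. Qed.

Lemma comp_id : comp (fun e : E => e).
Proof. by exists id => //; exact: recursive1_id. Qed.

Lemma comp_pair T1 T2 {e1 : Enc T1} {e2 : Enc T2} (A : E -> T1) (B : E -> T2) :
  comp A -> comp B -> comp (fun e => (A e, B e)).
Proof.
move=> [f rf fA] [g rg gB]; exists (fun x => ncons (f x) (g x)).
  exact: recursive1_comp2 recursive2_ncons rf rg.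
by move=> e; rewrite fA gB.
Qed.

Lemma comp_fst T1 T2 {e1 : Enc T1} {e2 : Enc T2} (A : E -> T1 * T2) :
  comp A -> comp (fun e => (A e).1).
Proof.
move=> [f rf fA]; exists (fun x => nhd (f x)).
  exact: recursive1_comp recursive1_nhd rf.
by move=> e; rewrite fA; case: (A e) => a b; exact: nhdK.
Qed.

Lemma comp_snd T1 T2 {e1 : Enc T1} {e2 : Enc T2} (A : E -> T1 * T2) :
  comp A -> comp (fun e => (A e).2).
Proof.
move=> [f rf fA]; exists (fun x => ntl (f x)).
  exact: recursive1_comp recursive1_ntl rf.
by move=> e; rewrite fA; case: (A e) => a b; exact: ntlK.
Qed.

Lemma comp_enc T {eT : Enc T} (A : E -> T) : comp A -> comp (fun e => enc (A e)).
Proof. by case=> f rf fA; exists f. Qed.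

Lemma comp_succ (A : E -> nat) : comp A -> comp (fun e => (A e).+1).
Proof. by case=> f rf fA; exists (fun x => (f x).+1) => [|e];
  [exact: recursive_succ|rewrite fA]. Qed.

Lemma comp_nat_of_bool (A : E -> bool) : comp A -> comp (fun e => nat_of_bool (A e)).
Proof. by case=> f rf fA; exists f. Qed.

Lemma comp_code (A : E -> seq nat) : comp A -> comp (fun e => code (A e)).
Proof. by case=> f rf fA; exists f => // e; rewrite fA enc_seq_nat. Qed.

Lemma comp_decode (A : E -> nat) : comp A -> comp (fun e => decode (A e)).
Proof. by case=> f rf fA; exists f => // e;
  rewrite fA enc_seq_nat CodeSeq.decodeK. Qed.

Lemma comp_eq (T : eqType) {eT : Enc T} (A B : E -> T) :
  comp A -> comp B -> comp (fun e => A e == B e).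
Proof.
move=> [f rf fA] [g rg gB]; exists (fun x => nat_of_bool (f x == g x)).
  exact: recursive1_eqn.
by move=> e; rewrite fA gB (inj_eq enc_inj).
Qed.

Lemma comp_if T {eT : Enc T} (c : E -> bool) (A B : E -> T) :
  comp c -> comp A -> comp B -> comp (fun e => if c e then A e else B e).
Proof.
move=> [h rh hc] [f rf fA] [g rg gB].
exists (fun x => if h x == 0 then g x else f x); first exact: recursive1_if.
by move=> e; rewrite hc fA gB /=; case: (c e).
Qed.

Lemma comp_andb (A B : E -> bool) : comp A -> comp B -> comp (fun e => A e && B e).
Proof. by move=> cA cB; apply: comp_if => //; exact: comp_const. Qed.

Lemma comp_orb (A B : E -> bool) : comp A -> comp B -> comp (fun e => A e || B e).
Proof. by move=> cA cB; apply: comp_if => //; exact: comp_const. Qed.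

Lemma comp_negb (A : E -> bool) : comp A -> comp (fun e => ~~ A e).
Proof. by move=> cA; apply: comp_if => //; exact: comp_const. Qed.

Lemma comp_case_tv T {eT : Enc T} (c : E -> tv) (A B C : E -> T) :
  comp c -> comp A -> comp B -> comp C ->
  comp (fun e => match c e with V0 => A e | Vh => B e | V1 => C e end).
Proof.
move=> cc cA cB cC; apply: (@comp_ext _ _ _ (fun e =>
    if c e == V0 then A e else if c e == Vh then B e else C e)).
  by move=> e; case: (c e).
by apply: comp_if => //; [|apply: comp_if => //]; apply: comp_eq => //;
  exact: comp_const.
Qed.

Lemma comp_designated (A : E -> tv) : comp A -> comp (fun e => designated (A e)).
Proof. by move=> cA; apply: comp_case_tv => //; exact: comp_const. Qed.

Lemma comp_tneg (A : E -> tv) : comp A -> comp (fun e => tneg (A e)).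
Proof. by move=> cA; apply: comp_case_tv => //; exact: comp_const. Qed.

Lemma comp_tinc (A : E -> tv) : comp A -> comp (fun e => tinc (A e)).
Proof. by move=> cA; apply: comp_case_tv => //; exact: comp_const. Qed.

Lemma comp_tmin (A B : E -> tv) : comp A -> comp B -> comp (fun e =>
  tmin (A e) (B e)).
Proof.
move=> cA cB; apply: (@comp_ext _ _ _ (fun e => match A e with V0 => V0
    | Vh => match B e with V0 => V0 | Vh => Vh | V1 => Vh end | V1 => B e end)).
  by move=> e; case: (A e); case: (B e).
by do 2?apply: comp_case_tv => //; exact: comp_const.
Qed.

Lemma comp_iter S {eS : Enc S} (n : E -> nat) (G : S -> E -> S) (z : E -> S) :
  comp (fun p : S * E => G p.1 p.2) -> comp n -> comp z ->
  comp (fun e => iter (n e) (fun s => G s e) (z e)).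
Proof.
move=> [g rg gG] [m rm mn] [f rf fz].
(* The single parameter [w] of the recursion codes both the starting value and the environment. *)
pose h k w := iter k (fun s => g (ncons s (ntl w))) (nhd w).
have rh : recursive2 h.
  apply: (@recursive2_prim nhd (fun _ r y => g (ncons r (ntl y)))) => //.
    exact: recursive1_nhd.
  apply: recursive_comp1 rg _; apply: recursive_comp2 recursive2_ncons _ _.
    exact: rec_proj.
  by apply: recursive_comp1 recursive1_ntl _; exact: rec_proj.
exists (fun x => h (m x) (ncons (f x) x)).
  apply: recursive1_comp2 rh rm _.
  exact: recursive1_comp2 recursive2_ncons rf recursive1_id.
move=> e; rewrite mn fz /h ntlK nhdK.
change (enc (n e)) with (n e); elim: (n e) => [//|k IH].
by rewrite !iterS IH -(gG (_, _)).
Qed.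

Lemma comp_cons T {eT : Enc T} (A : E -> T) (B : E -> seq T) :
  comp A -> comp B -> comp (fun e => A e :: B e).
Proof.
move=> [f rf fA] [g rg gB]; exists (fun x => ncons (f x) (g x)).
  exact: recursive1_comp2 recursive2_ncons rf rg.
by move=> e; rewrite fA gB.
Qed.

Lemma comp_case_seq T T' {eT : Enc T} {eT' : Enc T'} (L : E -> seq T) (Z : E -> T')
    (C : T -> seq T -> E -> T') :
  comp (fun p : (T * seq T) * E => C p.1.1 p.1.2 p.2) -> comp L -> comp Z ->
  comp (fun e => match L e with [::] => Z e | x :: r => C x r e end).
Proof.
move=> [c rc cC] [l rl lL] [z rz zZ].
(* The empty list has code 0, and the code of a nonempty list is already that of the pair of its
   head and tail, so it is passed on unchanged. *)
exists (fun x => if l x == 0 then z x else c (ncons (l x) x)).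
  apply: (recursive1_if rl rz); apply: (recursive1_comp rc).
  exact: recursive1_comp2 recursive2_ncons rl recursive1_id.
move=> e; rewrite lL zZ; case: (L e) => [//|x r].
by rewrite enc_cons gtn_eqF ?ncons_gt0// -(cC ((_, _), _)).
Qed.
End Comp.

Lemma comp_app E T1 T {eE : Enc E} {e1 : Enc T1} {eT : Enc T}
    (f : T1 -> T) (A : E -> T1) :
  comp f -> comp A -> comp (fun e => f (A e)).
Proof.
move=> [g rg gf] [h rh hA]; exists (fun x => g (h x)); first exact: recursive1_comp.
by move=> e; rewrite hA gf.
Qed.

(* The constant case comes last: its pattern also matches eta-expanded
   projections. *)
Ltac comp_proj := repeat lazymatch goal with
  | |- comp (fun e => e) => exact: comp_id
  | |- comp fst => refine (comp_fst (A := fun e => e) _)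
  | |- comp snd => refine (comp_snd (A := fun e => e) _)
  | |- comp (fun e => (@?A e, @?B e)) => refine (comp_pair (A := A) (B := B) _ _)
  | |- comp (fun e => fst (@?A e)) => refine (comp_fst (A := A) _)
  | |- comp (fun e => snd (@?A e)) => refine (comp_snd (A := A) _)
  | |- comp (fun e => ?x) => exact: comp_const
  end.

Section CompSeq.
Context (E T : Type) {eE : Enc E} {eT : Enc T}.

(** One step of a left fold, acting on the remaining list and the accumulator and idle once the list
    is empty. *)
Definition pop S (G : S -> T -> E -> S) e (st : seq T * S) : seq T * S :=
  match st.1 with [::] => st | x :: r => (r, G st.2 x e) end.

Lemma iter_pop S (G : S -> T -> E -> S) e l z n : size l <= n ->
  (iter n (pop G e) (l, z)).2 = foldl (fun a x => G a x e) z l.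
Proof.
elim: n l z => [|n IH] [|x l] z // le_n.
  by rewrite (@iter_fix _ _ _ ([::], z)).
by rewrite iterSr /pop -/(pop G e) IH.
Qed.

Lemma size_le_code (s : seq nat) : size s <= code s.
Proof.
elim: s => //= x s IH; rewrite -[2 ^ x * _]/(ncons x (code s)).
apply: leq_trans (_ : (code s).*2.+1 <= _); first by lia.
by rewrite leq_pmull// expn_gt0.
Qed.

Lemma comp_foldl S {eS : Enc S} (G : S -> T -> E -> S) (z : E -> S) (l : E -> seq T) :
  comp (fun p : (S * T) * E => G p.1.1 p.1.2 p.2) -> comp z -> comp l ->
  comp (fun e => foldl (fun a x => G a x e) (z e) (l e)).
Proof.
move=> cG cz cl.
(* The code of the list bounds its length and serves as the number of steps; the surplus steps
   change nothing. *)
apply: (@comp_ext _ _ _ _ _ (fun e => (iter (enc (l e)) (fun st =>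
  pop G e st) (l e, z e)).2)).
  by move=> e; rewrite iter_pop// -(size_map enc) size_le_code.
apply: comp_snd; apply: comp_iter; [|exact: comp_enc|exact: comp_pair].
apply: comp_case_seq; last 2 first.
- by do 2!apply: comp_fst; exact: comp_id.
- by apply: comp_fst; exact: comp_id.
apply: comp_pair; first by comp_proj.
apply: (comp_app (f := fun p : (S * T) * E => G p.1.1 p.1.2 p.2)
  (A := fun p : (T * seq T) * ((seq T * S) * E) => ((p.2.1.2, p.1.1), p.2.2))) => //.
by comp_proj.
Qed.

(** A right fold is a left fold over the reversed list, and reversal is itself a left fold. *)
Lemma comp_foldr S {eS : Enc S} (G : T -> S -> E -> S) (z : E -> S) (l : E -> seq T) :
  comp (fun p : (T * S) * E => G p.1.1 p.1.2 p.2) -> comp z -> comp l ->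
  comp (fun e => foldr (fun x a => G x a e) (z e) (l e)).
Proof.
move=> cG cz cl.
apply: (@comp_ext _ _ _ _ _ (fun e =>
  foldl (fun a x => G x a e) (z e) (foldl (fun s x => x :: s) [::] (l e)))) => [e|].
  rewrite -(foldl_rev (fun a x => G x a e)) /rev; congr foldl.
  by elim: (l e) [::] => //= x s IH a; rewrite IH.
apply: comp_foldl => //.
  apply: (comp_app (f := fun p : (T * S) * E => G p.1.1 p.1.2 p.2)
    (A := fun p : (S * T) * E => ((p.1.2, p.1.1), p.2))) => //.
  by comp_proj.
by apply: comp_foldl => //; [apply: comp_cons; comp_proj|exact: comp_const].
Qed.
End CompSeq.

Section CompSeqOps.
Context (E T : Type) {eE : Enc E} {eT : Enc T}.

Lemma comp_map T' {eT' : Enc T'} (F : T -> E -> T') (l : E -> seq T) :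
  comp (fun p : T * E => F p.1 p.2) -> comp l ->
  comp (fun e => [seq F x e | x <- l e]).
Proof.
move=> cF cl; apply: (@comp_ext _ _ _ _ _
  (fun e => foldr (fun x s => F x e :: s) [::] (l e))) => [e|].
  by elim: (l e) => //= x s ->.
apply: comp_foldr => //; last exact: comp_const.
apply: comp_cons; last by comp_proj.
by apply: (comp_app (f := fun p : T * E => F p.1 p.2)
  (A := fun p : (T * seq T') * E => (p.1.1, p.2))) => //; comp_proj.
Qed.

Lemma comp_find (Q : T -> E -> bool) (l : E -> seq T) :
  comp (fun p : T * E => Q p.1 p.2) -> comp l -> comp (fun e => find (fun x =>
    Q x e) (l e)).
Proof.
move=> cQ cl; apply: (@comp_ext _ _ _ _ _
  (fun e => foldr (fun x n => if Q x e then 0 else n.+1) 0 (l e))) => [e|].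
  by elim: (l e) => //= x s ->.
apply: comp_foldr => //; last exact: comp_const.
apply: comp_if; [|exact: comp_const|by apply: comp_succ; comp_proj].
by apply: (comp_app (f := fun p : T * E => Q p.1 p.2)
  (A := fun p : (T * nat) * E => (p.1.1, p.2))) => //; comp_proj.
Qed.

Lemma comp_filter (Q : T -> E -> bool) (l : E -> seq T) :
  comp (fun p : T * E => Q p.1 p.2) -> comp l -> comp (fun e =>
    [seq x <- l e | Q x e]).
Proof.
move=> cQ cl; apply: (@comp_ext _ _ _ _ _
  (fun e => foldr (fun x s => if Q x e then x :: s else s) [::] (l e))) => [e|].
  by elim: (l e) => //= x s ->.
apply: comp_foldr => //; last exact: comp_const.
apply: comp_if; [|by apply: comp_cons; comp_proj|by comp_proj].
by apply: (comp_app (f := fun p : T * E => Q p.1 p.2)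
  (A := fun p : (T * seq T) * E => (p.1.1, p.2))) => //; comp_proj.
Qed.

Lemma comp_all (Q : T -> E -> bool) (l : E -> seq T) :
  comp (fun p : T * E => Q p.1 p.2) -> comp l -> comp (fun e => all (fun x =>
    Q x e) (l e)).
Proof.
move=> cQ cl; apply: (@comp_ext _ _ _ _ _
  (fun e => foldr (fun x b => Q x e && b) true (l e))) => [e|].
  by elim: (l e) => //= x s ->.
apply: comp_foldr => //; last exact: comp_const.
apply: comp_andb; last by comp_proj.
by apply: (comp_app (f := fun p : T * E => Q p.1 p.2)
  (A := fun p : (T * bool) * E => (p.1.1, p.2))) => //; comp_proj.
Qed.

Lemma comp_has (Q : T -> E -> bool) (l : E -> seq T) :
  comp (fun p : T * E => Q p.1 p.2) -> comp l -> comp (fun e => has (fun x =>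
    Q x e) (l e)).
Proof.
move=> cQ cl; apply: (@comp_ext _ _ _ _ _
  (fun e => ~~ all (fun x => ~~ Q x e) (l e))) => [e|].
  by rewrite -has_predC; apply: eq_has => x /=; rewrite negbK.
by apply/comp_negb/comp_all => //; exact: comp_negb.
Qed.

Lemma comp_cat (A B : E -> seq T) : comp A -> comp B -> comp (fun e => A e ++ B e).
Proof.
move=> cA cB; apply: (@comp_ext _ _ _ _ _
  (fun e => foldr (fun x s => x :: s) (B e) (A e))) => [e|];
    first by elim: (A e) => //= x s ->.
by apply: comp_foldr => //; apply: comp_cons; comp_proj.
Qed.

Lemma comp_size (A : E -> seq T) : comp A -> comp (fun e => size (A e)).
Proof.
move=> cA; apply: (@comp_ext _ _ _ _ _
  (fun e => foldr (fun _ n => n.+1) 0 (A e))) => [e|].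
  by elim: (A e) => //= x s ->.
by apply: comp_foldr => //; [apply: comp_succ; comp_proj|exact: comp_const].
Qed.

Lemma comp_head (x0 : E -> T) (A : E -> seq T) :
  comp x0 -> comp A -> comp (fun e => head (x0 e) (A e)).
Proof.
by move=> cx cA; apply: (@comp_case_seq _ _ _ _ _ _ _ _ (fun x _ _ => x)) =>
    //; comp_proj.
Qed.

Lemma comp_behead (A : E -> seq T) : comp A -> comp (fun e => behead (A e)).
Proof.
by move=> cA; apply: (@comp_case_seq _ _ _ _ _ _ _ _ (fun _ r _ => r)) =>
    //; comp_proj.
Qed.
End CompSeqOps.

Section CompSeqOps2.
Context (E T : Type) {eE : Enc E} {eT : Enc T}.

Lemma comp_flatten (A : E -> seq (seq T)) : comp A -> comp (fun e => flatten (A e)).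
Proof.
move=> cA; apply: (@comp_foldr _ _ _ _ _ _ (fun x s _ => x ++ s)) => //;
  last exact: comp_const.
by apply: comp_cat; comp_proj.
Qed.

Lemma comp_nth (x0 : E -> T) (A : E -> seq T) (n : E -> nat) :
  comp x0 -> comp A -> comp n -> comp (fun e => nth (x0 e) (A e) (n e)).
Proof.
move=> cx cA cn; apply: (@comp_ext _ _ _ _ _
    (fun e => head (x0 e) (iter (n e) (fun s => behead s) (A e)))) => [e|].
  rewrite -nth0; have -> : iter (n e) (fun s => behead s) (A e) = drop (n e) (A e).
    elim: (n e) => [|k /= ->]; first by rewrite drop0.
    by rewrite -drop1 drop_drop add1n.
  by rewrite nth_drop addn0.
apply: comp_head => //; apply: comp_iter => //; apply: comp_behead; comp_proj.
Qed.

Lemma comp_iota (n : E -> nat) : comp n -> comp (fun e => iota 0 (n e)).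
Proof.
move=> cn; apply: (@comp_ext _ _ _ _ _
    (fun e => iter (n e) (fun s => s ++ [:: size s]) [::])) => [e|].
  elim: (n e) => // k IH; rewrite -[in LHS]addn1 iotaD IH iterS -IH.
  by rewrite size_iota.
apply: comp_iter => //; last exact: comp_const.
apply: comp_cat; first by comp_proj.
by apply: comp_cons; [apply: comp_size; comp_proj|exact: comp_const].
Qed.

Lemma comp_pred (n : E -> nat) : comp n -> comp (fun e => (n e).-1).
Proof.
case=> f rf fn; exists (fun x => (f x).-1);
  first exact: recursive1_comp recursive1_pred rf.
by move=> e; rewrite fn.
Qed.

End CompSeqOps2.

Lemma comp_index E (T : eqType) {eE : Enc E} {eT : Enc T} (x : E -> T)
    (l : E -> seq T) :
  comp x -> comp l -> comp (fun e => index (x e) (l e)).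
Proof.
move=> cx cl; apply: (@comp_find _ _ _ _ (fun y e => y == x e)) => //.
apply: comp_eq; first by comp_proj.
by apply: (comp_app (f := x) (A := snd)) => //; comp_proj.
Qed.

(* Redefined below each time new functions have been proved computable. *)
Ltac comp_user := fail.

Ltac comp_core := lazymatch goal with
  | |- comp (fun e => e) => exact: comp_id
  | |- comp fst => refine (comp_fst (A := fun e => e) _)
  | |- comp snd => refine (comp_snd (A := fun e => e) _)
  | |- comp (fun e => (@?A e, @?B e)) => refine (comp_pair (A := A) (B := B) _ _)
  | |- comp (fun e => fst (@?A e)) => refine (comp_fst (A := A) _)
  | |- comp (fun e => snd (@?A e)) => refine (comp_snd (A := A) _)
  | |- comp (fun e => S (@?A e)) => refine (comp_succ (A := A) _)
  | |- comp (fun e => predn (@?A e)) => refine (comp_pred (n := A) _)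
  | |- comp (fun e => code (@?A e)) => refine (comp_code (A := A) _)
  | |- comp (fun e => decode (@?A e)) => refine (comp_decode (A := A) _)
  | |- comp (fun e => nat_of_bool (@?A e)) => refine (comp_nat_of_bool (A := A) _)
  | |- comp (fun e => code_tv (@?A e)) => refine (comp_enc (A := A) _)
  | |- comp (fun e => @?A e == @?B e) => apply: comp_eq
  | |- comp (fun e => @?A e && @?B e) => refine (comp_andb (A := A) (B := B) _ _)
  | |- comp (fun e => @?A e || @?B e) => refine (comp_orb (A := A) (B := B) _ _)
  | |- comp (fun e => ~~ @?A e) => refine (comp_negb (A := A) _)
  | |- comp (fun e => designated (@?A e)) => refine (comp_designated (A := A) _)
  | |- comp (fun e => tneg (@?A e)) => refine (comp_tneg (A := A) _)
  | |- comp (fun e => tinc (@?A e)) => refine (comp_tinc (A := A) _)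
  | |- comp (fun e => tmin (@?A e) (@?B e)) =>
    refine (comp_tmin (A := A) (B := B) _ _)
  | |- comp (fun e => @?A e :: @?B e) => refine (comp_cons (A := A) (B := B) _ _)
  | |- comp (fun e => @?A e ++ @?B e) => refine (comp_cat (A := A) (B := B) _ _)
  | |- comp (fun e => flatten (@?A e)) => refine (comp_flatten (A := A) _)
  | |- comp (fun e => size (@?A e)) => refine (comp_size (A := A) _)
  | |- comp (fun e => iota 0 (@?A e)) => refine (comp_iota (n := A) _)
  | |- comp (fun e => nth (@?x e) (@?A e) (@?n e)) =>
      refine (comp_nth (x0 := x) (A := A) (n := n) _ _ _)
  | |- comp (fun e => index (@?x e) (@?A e)) => apply: comp_index
  | |- comp (fun e => iter (@?A e) (@?G e) (@?z e)) => apply: comp_iter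
  | |- comp (fun e => foldr (@?G e) (@?z e) (@?A e)) => apply: comp_foldr
  | |- comp (fun e => map (@?G e) (@?A e)) => apply: comp_map
  | |- comp (fun e => filter (@?G e) (@?A e)) => apply: comp_filter
  | |- comp (fun e => all (@?G e) (@?A e)) => apply: comp_all
  | |- comp (fun e => has (@?G e) (@?A e)) => apply: comp_has
  | |- comp (fun e => find (@?G e) (@?A e)) => apply: comp_find
  | |- comp (fun e => ?x) => exact: comp_const
  end.
Ltac comp_var := match goal with
  | H : comp ?B |- comp (fun e => ?B (@?A e)) =>
    refine (comp_app (f := B) (A := A) H _)
  end.
Ltac comp_step := first [comp_core | comp_user | assumption | comp_var
  | apply: comp_if | apply: comp_case_seq].
Ltac comp_tac := repeat comp_step.

(** * The decision procedure *)

(* The item (x, r) stands for the formula with code x evaluated after the updates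
   in r, the last one being listed first.  An entry (u, e) of r consists of the
   code [n; frame; pre; binds] of an update model and of an action. *)
Definition item := (nat * seq (nat * nat))%type.

Definition fld (x k : nat) := nth 0 (decode x) k.

Lemma comp_fld E (eE : Enc E) (A B : E -> nat) :
  comp A -> comp B -> comp (fun e => fld (A e) (B e)).
Proof. by move=> cA cB; rewrite /fld; comp_tac. Qed.

Ltac comp_field := lazymatch goal with
  | |- comp (fun e => fld (@?A e) (@?B e)) => refine (comp_fld (A := A) (B := B) _ _)
  end.
Ltac comp_user ::= comp_field.

Definition epre (w : nat * nat) := fld (fld w.1 2) w.2.
Definition ebinds (w : nat * nat) := decode (fld (fld w.1 3) w.2).
Definition erel (i : nat) (w : nat * nat) (f : nat) :=
  fld (fld (fld (fld w.1 1) i) w.2) f != 0.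
(** The default is the code of the variable numbered [p]; the right fold lets the first binding win,
    as in [lookup]. *)
Definition epost (w : nat * nat) (p : nat) :=
  foldr (fun c d => if fld c 0 == p then fld c 1 else d) (code [:: 0; p]) (ebinds w).
Definition entry (x : nat) : nat * nat :=
  (code [:: fld x 1; fld x 2; fld x 3; fld x 4], fld x 5).

Lemma comp_epre E (eE : Enc E) (A : E -> nat * nat) :
  comp A -> comp (fun e => epre (A e)).
Proof. by move=> cA; rewrite /epre; comp_tac. Qed.

Lemma comp_ebinds E (eE : Enc E) (A : E -> nat * nat) :
  comp A -> comp (fun e => ebinds (A e)).
Proof. by move=> cA; rewrite /ebinds; comp_tac. Qed.

Lemma comp_erel E (eE : Enc E) (A C : E -> nat) (B : E -> nat * nat) :
  comp A -> comp B -> comp C -> comp (fun e => erel (A e) (B e) (C e)).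
Proof. by move=> cA cB cC; rewrite /erel; comp_tac. Qed.

Ltac comp_update := lazymatch goal with
  | |- comp (fun e => epre (@?A e)) => refine (comp_epre (A := A) _)
  | |- comp (fun e => ebinds (@?A e)) => refine (comp_ebinds (A := A) _)
  | |- comp (fun e => erel (@?A e) (@?B e) (@?C e)) =>
      refine (comp_erel (A := A) (B := B) (C := C) _ _ _)
  | |- _ => comp_field
  end.
Ltac comp_user ::= comp_update.

Lemma comp_epost E (eE : Enc E) (A : E -> nat * nat) (B : E -> nat) :
  comp A -> comp B -> comp (fun e => epost (A e) (B e)).
Proof. by move=> cA cB; rewrite /epost; comp_tac. Qed.

Lemma comp_entry E (eE : Enc E) (A : E -> nat) :
  comp A -> comp (fun e => entry (A e)).
Proof. by move=> cA; rewrite /entry; comp_tac. Qed.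

(* The sequences of updates that agent i cannot distinguish from r. *)
Definition variants (i : nat) (r : seq (nat * nat)) : seq (seq (nat * nat)) :=
  foldr (fun w acc =>
    flatten [seq [seq (w.1, f) :: r' | r' <- acc] |
      f <- [seq f <- iota 0 (fld w.1 0).+1 | erel i w f]]) [:: [::]] r.

(* The items that must be designated for the updates in r to be executable. *)
Definition exitems (r : seq (nat * nat)) : seq item :=
  (foldr (fun w st => ((epre w, st.2) :: st.1, w :: st.2)) ([::], [::]) r).1.

Lemma comp_variants E (eE : Enc E) (A : E -> nat) (B : E -> seq (nat * nat)) :
  comp A -> comp B -> comp (fun e => variants (A e) (B e)).
Proof. by move=> cA cB; rewrite /variants; comp_tac. Qed.

Lemma comp_exitems E (eE : Enc E) (B : E -> seq (nat * nat)) :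
  comp B -> comp (fun e => exitems (B e)).
Proof. by move=> cB; rewrite /exitems; comp_tac. Qed.

Ltac comp_stack := lazymatch goal with
  | |- comp (fun e => epost (@?A e) (@?B e)) =>
      refine (comp_epost (A := A) (B := B) _ _)
  | |- comp (fun e => entry (@?A e)) => refine (comp_entry (A := A) _)
  | |- comp (fun e => variants (@?A e) (@?B e)) =>
      refine (comp_variants (A := A) (B := B) _ _)
  | |- comp (fun e => exitems (@?A e)) => refine (comp_exitems (B := A) _)
  | |- _ => comp_update
  end.
Ltac comp_user ::= comp_stack.

(** The items on which the value, or for a K-item the body value, depends. A K-item also needs the
    preconditions along every variant, since these decide which variants exist at a state. *)
Definition subitems (it : item) : seq item :=
  if fld it.1 0 == 0 then
    match it.2 with [::] => [::] | w :: r => [:: (epost w (fld it.1 1), r)] end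
  else if (fld it.1 0 == 1) || (fld it.1 0 == 2) then [:: (fld it.1 1, it.2)]
  else if fld it.1 0 == 3 then [:: (fld it.1 1, it.2); (fld it.1 2, it.2)]
  else if fld it.1 0 == 4 then
    flatten [seq (fld it.1 2, r) :: exitems r | r <- variants (fld it.1 1) it.2]
  else [:: (epre (entry it.1), it.2); (fld it.1 6, entry it.1 :: it.2)].

Definition is_know (it : item) := fld it.1 0 == 4.

Definition exists_at (v : item -> tv) (r : seq (nat * nat)) :=
  all (fun it => designated (v it)) (exitems r).

(* The contribution of a state to the infimum that is the value of a K-item. *)
Definition body_value (v : item -> tv) (it : item) : tv :=
  foldr (fun r a => tmin (v (fld it.1 2, r)) a) V1
    [seq r <- variants (fld it.1 1) it.2 | exists_at v r].

(* K-items and variables before any update are not constrained. *)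
Definition local_value (v : item -> tv) (it : item) : tv :=
  if fld it.1 0 == 0 then
    match it.2 with [::] => v it | w :: r => v (epost w (fld it.1 1), r) end
  else if fld it.1 0 == 1 then tneg (v (fld it.1 1, it.2))
  else if fld it.1 0 == 2 then tinc (v (fld it.1 1, it.2))
  else if fld it.1 0 == 3 then tmin (v (fld it.1 1, it.2)) (v (fld it.1 2, it.2))
  else if fld it.1 0 == 4 then v it
  else if designated (v (epre (entry it.1), it.2)) then
    v (fld it.1 6, entry it.1 :: it.2)
  else V1.

(** The start item has [measure] equal to [x] and each passage to subitems lowers it, so [x.+1]
    rounds reach a closed list. *)
Definition closure (x : nat) : seq item :=
  iter x.+1 (fun C => C ++ flatten [seq subitems it | it <- C]) [:: (x, [::])].

Section Types.
Implicit Types (x : nat) (C : seq item) (t : seq tv) (T : seq (seq tv)).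

(* A type t lists the values of the items in C in order. *)
Definition read C t (it : item) : tv := nth V0 t (index it C).

Definition agree (i : nat) C t t' :=
  all (fun it => ~~ (is_know it && (fld it.1 1 == i)) ||
    (read C t it == read C t' it)) C.

(** The second test says that the value of a K-item is at most the body value at the type itself.
    Related types have the same K-values, so the bound extends to the whole class. *)
Definition locally_ok C t :=
  all (fun it => (read C t it == local_value (read C t) it) &&
    (~~ is_know it ||
      (tmin (read C t it) (body_value (read C t) it) == read C t it))) C.

Definition witnessed C T t :=
  all (fun it => ~~ is_know it ||
    has (fun t' => agree (fld it.1 1) C t t' &&
      (body_value (read C t') it == read C t it)) T) C.

Definition good C T := all (fun t => locally_ok C t && witnessed C T t) T.

Definition all_types C : seq (seq tv) :=
  foldr (fun _ acc =>
    flatten [seq [:: V0 :: t; Vh :: t; V1 :: t] | t <- acc]) [:: [::]] C.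

Definition sublists T : seq (seq (seq tv)) :=
  foldr (fun t acc => [seq t :: s | s <- acc] ++ acc) [:: [::]] T.

Definition realizes x C t := designated (read C t (x, [::])).

Definition candidates x C :=
  [seq T <- sublists (all_types C) | good C T && has (fun t => realizes x C t) T].

(** Arranged to equal [code_fmodel] of the model whose states are the positions in [T]; the
    predecessor of the size appears because a frame of index [n] has [n.+1] points. *)
Definition code_types q C T : nat :=
  code [:: (size T).-1;
    code [seq code [seq code [seq nat_of_bool (agree i C t t') | t' <- T] | t <- T]
         | i <- iota 0 q];
    code [seq code [seq code [:: fld it.1 1; code_tv (read C t it)]
                   | it <- [seq it <- C | (fld it.1 0 == 0) && (it.2 == [::])]]
         | t <- T]].

(** An unsatisfiable formula has value 0 everywhere, so the fixed model with state 0 serves as the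
    negative answer. *)
Definition answer m q x C (l : seq (seq (seq tv))) : nat :=
  match l with
  | [::] => code [:: 0; m; 0]
  | T :: _ => code [:: 1; code_types q C T; find (fun t => realizes x C t) T]
  end.

(* m is the code of some fixed model, and q the number of agents. *)
Definition decide m q x := answer m q x (closure x) (candidates x (closure x)).

End Types.

Section CompDecide.
Context (E : Type) (eE : Enc E).
Implicit Types (C : E -> seq item) (t : E -> seq tv) (T : E -> seq (seq tv)).

Lemma comp_subitems (A : E -> item) : comp A -> comp (fun e => subitems (A e)).
Proof. by move=> cA; rewrite /subitems; comp_tac. Qed.

Lemma comp_is_know (A : E -> item) : comp A -> comp (fun e => is_know (A e)).
Proof. by move=> cA; rewrite /is_know; comp_tac. Qed.

Lemma comp_read C t (A : E -> item) : comp C -> comp t -> comp A ->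
  comp (fun e => read (C e) (t e) (A e)).
Proof. by move=> cC ct cA; rewrite /read; comp_tac. Qed.
End CompDecide.

Ltac comp_item := lazymatch goal with
  | |- comp (fun e => subitems (@?A e)) => refine (comp_subitems (A := A) _)
  | |- comp (fun e => is_know (@?A e)) => refine (comp_is_know (A := A) _)
  | |- comp (fun e => read (@?A e) (@?B e) (@?C e)) =>
      refine (comp_read (C := A) (t := B) (A := C) _ _ _)
  | |- _ => comp_stack
  end.
Ltac comp_user ::= comp_item.

Section CompDecide2.
Context (E : Type) (eE : Enc E).
Implicit Types (C : E -> seq item) (t : E -> seq tv) (T : E -> seq (seq tv)).

Lemma comp_body_value C t (A : E -> item) : comp C -> comp t -> comp A ->
  comp (fun e => body_value (read (C e) (t e)) (A e)).
Proof. by move=> cC ct cA; rewrite /body_value /exists_at; comp_tac. Qed.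

Lemma comp_local_value C t (A : E -> item) : comp C -> comp t -> comp A ->
  comp (fun e => local_value (read (C e) (t e)) (A e)).
Proof. by move=> cC ct cA; rewrite /local_value; comp_tac. Qed.

Lemma comp_agree (i : E -> nat) C t t' : comp i -> comp C -> comp t -> comp t' ->
  comp (fun e => agree (i e) (C e) (t e) (t' e)).
Proof. by move=> ci cC ct ct'; rewrite /agree; comp_tac. Qed.

Lemma comp_closure (A : E -> nat) : comp A -> comp (fun e => closure (A e)).
Proof. by move=> cA; rewrite /closure; comp_tac. Qed.

Lemma comp_all_types C : comp C -> comp (fun e => all_types (C e)).
Proof. by move=> cC; rewrite /all_types; comp_tac. Qed.

Lemma comp_sublists T : comp T -> comp (fun e => sublists (T e)).
Proof. by move=> cT; rewrite /sublists; comp_tac. Qed.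
End CompDecide2.

Ltac comp_type := lazymatch goal with
  | |- comp (fun e => body_value (read (@?C e) (@?t e)) (@?A e)) =>
      refine (comp_body_value (C := C) (t := t) (A := A) _ _ _)
  | |- comp (fun e => local_value (read (@?C e) (@?t e)) (@?A e)) =>
      refine (comp_local_value (C := C) (t := t) (A := A) _ _ _)
  | |- comp (fun e => agree (@?i e) (@?C e) (@?t e) (@?t' e)) =>
      refine (comp_agree (i := i) (C := C) (t := t) (t' := t') _ _ _ _)
  | |- comp (fun e => closure (@?A e)) => refine (comp_closure (A := A) _)
  | |- comp (fun e => all_types (@?A e)) => refine (comp_all_types (C := A) _)
  | |- comp (fun e => sublists (@?A e)) => refine (comp_sublists (T := A) _)
  | |- _ => comp_item
  end.
Ltac comp_user ::= comp_type.

Lemma comp_good E (eE : Enc E) (C : E -> seq item) T : comp C -> comp T ->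
  comp (fun e => good (C e) (T e)).
Proof. by move=> cC cT; rewrite /good /locally_ok /witnessed; comp_tac. Qed.

Lemma comp_code_types E (eE : Enc E) q (C : E -> seq item) T : comp C -> comp T ->
  comp (fun e => code_types q (C e) (T e)).
Proof. by move=> cC cT; rewrite /code_types; comp_tac. Qed.

Ltac comp_user ::= lazymatch goal with
  | |- comp (fun e => good (@?A e) (@?B e)) =>
    refine (comp_good (C := A) (T := B) _ _)
  | |- comp (fun e => code_types _ (@?A e) (@?B e)) =>
      refine (comp_code_types _ (C := A) (T := B) _ _)
  | |- _ => comp_type
  end.

Lemma comp_decide m q : comp (decide m q).
Proof.
rewrite /decide /candidates /answer /realizes.
apply: comp_case_seq; comp_tac.
Qed.

Local Arguments CodeSeq.code : simpl never.

(** * Correctness of the decision procedure *)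

Section Codes.
Implicit Types (x : nat) (s : seq nat) (w : nat * nat) (r : seq (nat * nat))
  (it : item).

Lemma fld_code s k : fld (code s) k = nth 0 s k.
Proof. by rewrite /fld CodeSeq.codeK. Qed.

Lemma leq_ncons x y z : y <= z -> ncons x y <= ncons x z.
Proof. by move=> yz; rewrite leq_mul2l ltnS leq_double yz orbT. Qed.

Lemma ncons_gtr x y : y < ncons x y.
Proof.
apply: (@leq_trans y.*2.+1); first by rewrite ltnS -addnn leq_addr.
by rewrite leq_pmull// expn_gt0.
Qed.

Lemma code_mem_lt s x : x \in s -> x < code s.
Proof.
elim: s => //= y s IH; rewrite inE => /predU1P[->|/IH xs].
  exact: (ncons_gt y (code s)).
exact: ltn_trans xs (ncons_gtr y _).
Qed.

Lemma code_cat_ge s1 s2 : code s1 + code s2 <= code (s1 ++ s2).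
Proof.
elim: s1 => [//|x s IH]; rewrite cat_cons !code_cons;
  apply: leq_trans (leq_ncons x IH).
rewrite /ncons doubleD; set k := 2 ^ x; have k0 : 0 < k by rewrite expn_gt0.
by nia.
Qed.

(** The actions are not counted, so all variants of a stack weigh the same. *)
Definition measure it := it.1 + sumn (map fst it.2).

Lemma exitems_cons w r : exitems (w :: r) = (epre w, r) :: exitems r.
Proof.
rewrite /exitems /=; set g := foldr _ _ r.
by have -> : g.2 = r by rewrite /g; elim: r {g} => //= w' r' ->.
Qed.

Lemma variantsP i w r r' : reflect
  (exists f r1, [/\ r' = (w.1, f) :: r1, f <= fld w.1 0,
    erel i w f & r1 \in variants i r])
  (r' \in variants i (w :: r)).
Proof.
apply: (iffP idP) => [/flattenP[_ /mapP[f ff ->]]|[f [r1 [-> fn ef r1v]]]].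
  move: ff; rewrite mem_filter mem_iota /= add0n ltnS =>
    /andP[ef fn] /mapP[r1 r1v ->].
  by exists f, r1.
apply/flattenP; exists [seq (w.1, f) :: r2 | r2 <- variants i r].
  by apply/mapP; exists f => //; rewrite mem_filter ef mem_iota.
by apply/mapP; exists r1.
Qed.

Lemma variants_nil i r' : (r' \in variants i [::]) = (r' == [::]).
Proof. by rewrite inE. Qed.

Lemma body_value_congr v v' it : is_know it ->
  (forall it', it' \in subitems it -> v it' = v' it') ->
  body_value v it = body_value v' it.
Proof.
rewrite /is_know /subitems /body_value => /eqP -> /= h.
have hr r it' : r \in variants (fld it.1 1) it.2 ->
    it' \in (fld it.1 2, r) :: exitems r -> v it' = v' it'.
  move=> rv it'r; apply: h; apply/flattenP;
    exists ((fld it.1 2, r) :: exitems r) => //.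
  by apply/mapP; exists r.
rewrite (@eq_in_filter _ (exists_at v) (exists_at v')) => [|r rv].
  elim: (variants _ _) hr {h} => //= r l IH hr.
  have IHl := IH (fun r' it' r'l => hr r' it' (mem_behead (s := _ :: _) r'l)).
  case: ifP => //= _; rewrite IHl.
  by congr tmin; apply: (hr r); rewrite ?mem_head.
by apply: eq_in_all => it' it'r; rewrite (hr r)// in_cons it'r orbT.
Qed.

Lemma local_value_congr v v' it : v it = v' it ->
  (forall it', it' \in subitems it -> v it' = v' it') ->
  local_value v it = local_value v' it.
Proof.
rewrite /local_value /subitems => hit.
case: (fld it.1 0) => [|[|[|[|[|k]]]]] //= h.
- by case: it.2 h => [//|w r] h; apply: h; rewrite mem_head.
- by rewrite h ?mem_head.
- by rewrite h ?mem_head.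
- by rewrite !h// !inE eqxx ?orbT.
- by rewrite !h// !inE eqxx ?orbT.
Qed.

End Codes.

Section Wf.
Context (P : countType) (N : finType).
Local Notation F := (form P N).
Implicit Types (a b : F) (x : nat) (w : nat * nat) (r : seq (nat * nat)) (it : item).

Definition code_umodel n (U : umodel P N F n) : nat :=
  code [:: n; code_frame (uframe U);
    code [seq code_form (pre U f) | f <- enum 'I_n.+1];
    code [seq code [seq code [:: pickle c.1; code_form c.2] | c <- binds U f]
         | f <- enum 'I_n.+1]].

Lemma fld_Upd n (U : umodel P N F n) e b :
  [/\ fld (code_form (Upd U e b)) 0 = 5,
    entry (code_form (Upd U e b)) = (code_umodel U, nat_of_ord e) &
      fld (code_form (Upd U e b)) 6 = code_form b].
Proof. by rewrite /entry /= !fld_code. Qed.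

Lemma fld_Var (p : P) : fld (code_form (Var N p)) 0 = 0 /\
  fld (code_form (Var N p)) 1 = pickle p.
Proof. by rewrite [code_form _]/= !fld_code. Qed.

Lemma fld_Neg b : fld (code_form (Neg b)) 0 = 1 /\
  fld (code_form (Neg b)) 1 = code_form b.
Proof. by rewrite [code_form _]/= !fld_code. Qed.

Lemma fld_Inc b : fld (code_form (Inc b)) 0 = 2 /\
  fld (code_form (Inc b)) 1 = code_form b.
Proof. by rewrite [code_form _]/= !fld_code. Qed.

Lemma fld_And a b : [/\ fld (code_form (And a b)) 0 = 3,
  fld (code_form (And a b)) 1 = code_form a
  & fld (code_form (And a b)) 2 = code_form b].
Proof. by rewrite [code_form _]/= !fld_code. Qed.

Lemma fld_Know i b : [/\ fld (code_form (Know i b)) 0 = 4,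
  fld (code_form (Know i b)) 1 = nat_of_ord (enum_rank i) & fld (code_form (Know i
    b)) 2 = code_form b].
Proof. by rewrite [code_form _]/= !fld_code. Qed.

Lemma nth_enum_map T (x0 : T) n (g : 'I_n.+1 -> T) (f : 'I_n.+1) :
  nth x0 [seq g h | h <- enum 'I_n.+1] f = g f.
Proof. by rewrite (nth_map ord0) ?size_enum_ord// nth_ord_enum. Qed.

Lemma epreE n (U : umodel P N F n) (f : 'I_n.+1) :
  epre (code_umodel U, nat_of_ord f) = code_form (pre U f).
Proof. by rewrite /epre /= /code_umodel fld_code /= fld_code nth_enum_map. Qed.

Lemma ebindsE n (U : umodel P N F n) (f : 'I_n.+1) :
  ebinds (code_umodel U, nat_of_ord f) =
  [seq code [:: pickle c.1; code_form c.2] | c <- binds U f].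
Proof. by rewrite /ebinds /= /code_umodel fld_code /= fld_code nth_enum_map
  CodeSeq.codeK. Qed.

Lemma epostE n (U : umodel P N F n) (f : 'I_n.+1) p :
  epost (code_umodel U, nat_of_ord f) (pickle p) = code_form (post U f p).
Proof.
rewrite /epost ebindsE /post; elim: (binds U f) => //= c l ->.
rewrite !fld_code /=; case: eqP => [/(pcan_inj pickleK) ->|ne]; first by rewrite eqxx.
by case: eqP => // pc; rewrite pc in ne.
Qed.

Lemma erelE n (U : umodel P N F n) i (e f : 'I_n.+1) :
  erel (enum_rank i) (code_umodel U, nat_of_ord e) f = frel (uframe U) i e f.
Proof.
rewrite /erel /= /code_umodel fld_code /= /code_frame fld_code (nth_map i) -?cardE
  ?ltn_ord//.
by rewrite nth_enum_rank !fld_code !nth_enum_map fld_code nth_enum_map; case: frel.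
Qed.

Lemma post_mem n (U : umodel P N F n) (f : 'I_n.+1) p :
  post U f p = Var N p \/ exists2 c, List.In c (binds U f) & post U f p = c.2.
Proof.
rewrite /post; elim: (binds U f) => [|c l IH] /=; first by left.
case: ifP => _; first by right; exists c => //; left.
by case: IH => [->|[d dl ->]]; [left|right; exists d => //; right].
Qed.

Definition wf_entry w := exists n (U : umodel P N F n) (f :
  'I_n.+1), w = (code_umodel U, nat_of_ord f).
Definition wf_stack r := forall w, w \in r -> wf_entry w.
Definition wf_item it := (exists a, it.1 = code_form a) /\ wf_stack it.2.

Lemma wf_stack_cons w r : wf_stack (w :: r) <-> wf_entry w /\ wf_stack r.
Proof.
split=> [h|[hw hr] w']; last by rewrite inE => /predU1P[->//|/hr].
by split=> [|w' w'r]; apply: h; rewrite inE ?eqxx// w'r orbT.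
Qed.

Lemma code_umodel_pre n (U : umodel P N F n) f : code_form (pre U f) < code_umodel U.
Proof.
apply: (@ltn_trans (code [seq code_form (pre U f) | f <- enum 'I_n.+1])).
  by apply: code_mem_lt; apply/mapP; exists f; rewrite ?mem_enum.
by apply: code_mem_lt; rewrite !inE eqxx !orbT.
Qed.

Lemma code_umodel_bind n (U : umodel P N F n) f (c : P * F) : List.In c (binds U f) ->
  code_form c.2 < code_umodel U.
Proof.
move=> cU; apply: (@ltn_trans (code [:: pickle c.1; code_form c.2])).
  by apply: code_mem_lt; rewrite !inE eqxx orbT.
set cs := fun f => code [seq code [:: pickle c.1; code_form c.2] | c <- binds U f].
apply: (@ltn_trans (cs f)).
  apply: code_mem_lt; elim: (binds U f) cU => //= d l IH [->|/IH];
    first by rewrite mem_head.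
  by rewrite inE orbC => ->.
apply: (@ltn_trans (code [seq cs f | f <- enum 'I_n.+1])).
  by apply: code_mem_lt; apply/mapP; exists f; rewrite ?mem_enum.
by apply: code_mem_lt; rewrite !inE eqxx !orbT.
Qed.

(** Unfolding an [Upd] item moves its update model to the stack, where it is counted separately.
    Superadditivity of [code] under concatenation bounds the sum, and the tag 5 makes the bound
    strict. *)
Lemma code_umodel_lt n (U : umodel P N F n) e b :
  code_umodel U + code_form b < code_form (Upd U e b).
Proof.
rewrite [code_form (Upd _ _ _)]/=.
set l := [:: n; _; _; _; nat_of_ord e; code_form b].
apply: (@leq_ltn_trans (code l)); last by rewrite (code_cons 5); exact: ncons_gtr.
apply: leq_trans (code_cat_ge (take 4 l) (drop 4 l)).
by rewrite leq_add2l ltnW// code_mem_lt// !inE eqxx orbT.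
Qed.

Lemma wf_variants i r r' : wf_stack r -> r' \in variants i r ->
  wf_stack r' /\ map fst r' = map fst r.
Proof.
elim: r r' => [|w r IH] r'; first by rewrite variants_nil => _ /eqP ->.
move=> /wf_stack_cons[[n [U [e ->]]] wr] /variantsP[f [r1 [-> fn _ r1v]]].
have [wr1 e1] := IH r1 wr r1v; split; last by rewrite /= e1.
apply/wf_stack_cons; split=> //; move: fn; rewrite fld_code /= -ltnS => fn.
by exists n, U, (Ordinal fn).
Qed.

Lemma wf_exitems r it : wf_stack r -> it \in exitems r ->
  wf_item it /\ measure it < sumn (map fst r).
Proof.
elim: r => [//|w r IH] /wf_stack_cons[[n [U [e ->]]] wr].
rewrite exitems_cons inE => /predU1P[->|/(IH wr)[? lt]]; split=> //=.
- by split=> //=; exists (pre U e); rewrite epreE.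
- by rewrite /measure /= epreE ltn_add2r code_umodel_pre.
- by apply: (leq_trans lt); rewrite leq_addl.
Qed.

Lemma wf_subitems it it' : wf_item it -> it' \in subitems it ->
  wf_item it' /\ measure it' < measure it.
Proof.
case: it => x r [[a /= ->] wr]; rewrite /subitems.
case: a => [p|b|b|b c|i b|n U e b].
- have [-> ->] /= := fld_Var p; case: r wr => //= w r.
  move=> /wf_stack_cons[[n [U [e ->]]] wr]; rewrite inE => /eqP ->; split.
    by split=> //=; exists (post U e p); rewrite epostE.
  rewrite /measure /= epostE addnA ltn_add2r; have [->|[c cU ->]] := post_mem U e p.
    by rewrite -[X in X < _]addn0 ltn_add2l (leq_ltn_trans _ (code_umodel_pre U e)).
  by apply: leq_trans (code_umodel_bind cU) _; rewrite leq_addl.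
- have [-> ->] /= := fld_Neg b; rewrite inE => /eqP ->; split;
  first by split=> //=; exists b.
  by rewrite /measure ltn_add2r code_mem_lt// !inE eqxx orbT.
- have [-> ->] /= := fld_Inc b; rewrite inE => /eqP ->; split;
  first by split=> //=; exists b.
  by rewrite /measure ltn_add2r code_mem_lt// !inE eqxx orbT.
- have [-> -> ->] /= := fld_And b c; rewrite !inE => /orP[]/eqP ->; split;
    rewrite /measure ?ltn_add2r ?code_mem_lt ?inE ?eqxx ?orbT//; split=> //=;
      by [exists b|exists c].
- have [-> -> ->] /= := fld_Know i b => /flattenP[_ /mapP[r' r'v ->]].
  have [wr' sr'] := wf_variants wr r'v;
    rewrite inE => /predU1P[->|/(wf_exitems wr')[? lt]].
    split; first by split=> //=; exists b.
    by rewrite /measure /= sr' ltn_add2r code_mem_lt// !inE eqxx !orbT.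
  by split=> //; apply: (leq_trans lt); rewrite sr' leq_addl.
- have [-> -> ->] /= := fld_Upd U e b; rewrite epreE; have lt := code_umodel_lt U e b.
  rewrite !inE => /orP[]/eqP ->; split.
  + by split=> //=; exists (pre U e).
  + rewrite /measure ltn_add2r; apply: ltn_trans (code_umodel_pre U e) _.
    by apply: leq_ltn_trans lt; rewrite leq_addr.
  + by split; [exists b|apply/wf_stack_cons; split=> //; exists n, U, e].
  + by rewrite /measure /= addnA ltn_add2r addnC.
Qed.

Lemma closureP a : let C := closure (code_form a) in
  [/\ (code_form a, [::]) \in C, forall it, it \in C -> wf_item it &
      forall it it', it \in C -> it' \in subitems it -> it' \in C].
Proof.
rewrite /closure; set x := code_form a; set step := fun C => _.
have wfx : wf_item (x, [::]) by split; [exists a|].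
(* Invariant: after [k] rounds, an item whose subitems are not all present has measure at most
   [x - k]. *)
suff h k : let C := iter k step [:: (x, [::])] in
  [/\ (x, [::]) \in C, forall it, it \in C -> wf_item it &
    forall it, it \in C -> (forall it', it' \in subitems it -> it' \in C) \/
      measure it + k <= x].
  have [xC wC cC] := h x.+1; split=> // it it' /cC[cl|]; first exact: cl.
  by rewrite addnS ltnNge leq_addl.
elim: k => [|k [xC wC cC]].
  split=> [|it|it]; rewrite /= inE// => /eqP -> //.
  by right; rewrite /measure /= !addn0.
rewrite [iter _ _ _]/= /step -/step; set C := iter k step _ in xC wC cC *.
have sub it it' : it \in C -> it' \in subitems it ->
    it' \in C ++ flatten [seq subitems it | it <- C].
  move=> itC it's; rewrite mem_cat; apply/orP; right; apply/flattenP.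
  by exists (subitems it) => //; apply/mapP; exists it.
split; first by rewrite mem_cat xC.
  move=> it; rewrite mem_cat => /orP[/wC//|/flattenP[_ /mapP[it1 it1C ->] it1s]].
  by have [] := wf_subitems (wC _ it1C) it1s.
move=> it; rewrite mem_cat => /orP[itC|/flattenP[_ /mapP[it1 it1C ->] it1s]].
  by left => it' /sub; apply.
have [cl|lt] := cC _ it1C; first by left => it' /sub; apply; exact: cl.
right; have [_ lt'] := wf_subitems (wC _ it1C) it1s.
by rewrite addnS; apply: leq_trans lt; rewrite ltn_add2r.
Qed.

End Wf.

(** * Infima of truth values, with the order written as [tmin c d = c] *)

Section Tinf.
Implicit Types (A : set tv) (c : tv).

Lemma tinf_le A c : A c -> tmin (tinf A) c = tinf A.
Proof.
rewrite /tinf; case: asboolP => // A0; case: asboolP => // Ah; by case: c => /=.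
Qed.

Lemma tinf_mem A c : A c -> A (tinf A).
Proof. by rewrite /tinf; case: asboolP => // A0; case: asboolP => // Ah; case: c. Qed.

Lemma tinf_eq A c : A c -> (forall c', A c' -> tmin c c' = c) -> tinf A = c.
Proof.
move=> Ac /(_ _ (tinf_mem Ac)) h; move: h (tinf_le Ac).
by case: c {Ac}; case: (tinf A).
Qed.

Lemma tmin_all (T : eqType) c (g : T -> tv) (l : seq T) :
  tmin c (foldr (fun x a => tmin (g x) a) V1 l) = c <-> forall x, x \in l ->
    tmin c (g x) = c.
Proof.
elim: l => [|y l IH] /=; first by case: c.
transitivity (tmin c (g y) = c /\ tmin c (foldr (fun x a => tmin (g x) a) V1 l) = c).
  by case: c {IH}; case: (g y); case: foldr; split=> // -[].
rewrite IH; split=> [[hy hl] x|h].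
  by rewrite inE => /predU1P[->|/hl].
by split=> [|x xl]; apply: h; rewrite inE ?eqxx// xl orbT.
Qed.

Lemma tmin_tinf A c : tmin c (tinf A) = c <-> forall c', A c' -> tmin c c' = c.
Proof.
split=> [h c' /tinf_le|h]; first by case: c h; case: (tinf A); case: c'.
rewrite /tinf; case: asboolP => [/h//|A0]; case: asboolP => [/h//|Ah].
by case: c {h}.
Qed.

(** Equality through lower bounds lets a single infimum be compared with an infimum of infima. *)
Lemma tmin_antisym c c' : (forall d, tmin d c = d <-> tmin d c' = d) -> c = c'.
Proof.
by move=> h; case: c c' h => -[] // h; have := h Vh; have := h V1;
  move=> [] /= ? ? [] ? ?; intuition.
Qed.

End Tinf.

(** * Evaluation of items in iterated updates *)

Section IteratedUpdate.
Context (P : countType) (N : finType).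
Local Notation F := (form P N).
Implicit Types (M : model P N) (a : F) (r : seq (nat * nat)) (it : item).

Definition tagged_umodel := {n : nat & umodel P N F n}.

(* M updated with the models in Us, the head of Us being applied last. *)
Fixpoint updates M (Us : seq tagged_umodel) : model P N :=
  if Us is U :: Us' then update (updates M Us') (tagged U) else M.

(** A state of an iterated update has two coordinates: the original state, given by [base], and the
    executed updates, given by [path]. *)
Fixpoint base M Us : updates M Us -> M :=
  match Us return updates M Us -> M with
  | [::] => id
  | U :: Us' => fun z => base (val z).1
  end.

Fixpoint path M Us : updates M Us -> seq (nat * nat) :=
  match Us return updates M Us -> seq (nat * nat) with
  | [::] => fun=> [::]
  | U :: Us' => fun z => (code_umodel (tagged U),
    nat_of_ord (val z).2) :: path (val z).1
  end.

Lemma acc_updates M Us i (z z' : updates M Us) :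
  acc i z z' <-> acc i (base z) (base z') /\
    path z' \in variants (enum_rank i) (path z).
Proof.
elim: Us z z' => [|U Us IH] z z'; first by rewrite /= mem_head; split=> [|[]].
transitivity (acc i (val z).1 (val z').1 /\
  frel (uframe (tagged U)) i (val z).2 (val z').2).
  by split.
rewrite IH -erelE; split=> [[[bz pz] ez]|[bz /variantsP[f [r [[fE rE] fn ef rv]]]]].
  split=> //; apply/variantsP.
  exists (nat_of_ord (val z').2), (path (val z').1); split=> //=.
  by rewrite fld_code /= -ltnS ltn_ord.
by rewrite fE rE.
Qed.

Lemma wf_path M Us (z : updates M Us) : @wf_stack P N (path z).
Proof.
elim: Us z => [//|[n U] Us IH] z; apply/wf_stack_cons; split; last exact: IH.
by exists n, U, (val z).2.
Qed.

Section ExistsAt.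
Context M (v : M -> item -> tv).

(** All sequences of updates are treated at once, because an [Upd] item leads to one more update and
    a variable item to one fewer. *)
Definition correct_at it := forall Us (z : updates M Us) a,
  it = (code_form a, path z) -> eval a z = v (base z) it.

Lemma path_exists_at Us (z : updates M Us) :
  (forall it, it \in exitems (path z) -> correct_at it) ->
  exists_at (v (base z)) (path z).
Proof.
rewrite /exists_at; elim: Us z => [//|[n U] Us IH] z h.
move: h; rewrite [path z]/= exitems_cons /= epreE => h; apply/andP; split.
  have dz := valP z; rewrite /= in dz.
  by move: dz; rewrite (h _ (mem_head _ _) _ (sval z).1 (pre U (sval z).2)).
by apply: IH => it itr; apply: h; rewrite inE itr orbT.
Qed.

(** Converse to [path_exists_at]: the state is built from the earliest update onwards, correctness
    of each precondition item showing that the next action is executable. *)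
Lemma variant_lift Us i (z : updates M Us) t r :
  r \in variants i (path z) ->
  (forall it, it \in exitems r -> correct_at it) -> exists_at (v t) r ->
  exists2 z' : updates M Us, base z' = t & path z' = r.
Proof.
elim: Us z r => [|[n U] Us IH] z r.
  by rewrite variants_nil => /eqP -> _ _; exists t.
move=> /variantsP[f [r1 [-> /= + _ r1v]]]; rewrite fld_code /= -ltnS => fn.
rewrite /exists_at exitems_cons /= => h /andP[d1 ex1].
have [||z1 bz1 pz1] := IH _ _ r1v; [|exact: ex1|].
  by move=> it itr; apply: h; rewrite inE itr orbT.
have d : designated (eval (pre U (Ordinal fn)) z1).
  rewrite (h _ (mem_head _ _) _ z1 (pre U (Ordinal fn))).
    by rewrite bz1.
  by rewrite pz1 -epreE.
by exists (exist _ (z1, Ordinal fn) d : update (updates M Us) U) => //=; rewrite pz1.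
Qed.

End ExistsAt.

Section Truth.
Context M (v : M -> item -> tv) (C : seq item).
Context (closedC : forall it it', it \in C -> it' \in subitems it -> it' \in C).
Context (v_var : forall s p, (code_form (Var N p), [::]) \in C ->
  v s (code_form (Var N p), [::]) = valu s p).
Context (v_local : forall s it, it \in C -> v s it = local_value (v s) it).
Context (v_know : forall s i a r, (code_form (Know i a), r) \in C ->
  v s (code_form (Know i a), r) =
    tinf [set body_value (v t) (code_form (Know i a), r) | t in acc i s]).

(** Induction on [measure]. It is used twice: for [value] over an arbitrary model, and for [read]
    over the finite model of types. *)
Lemma truth it : it \in C -> correct_at v it.
Proof.
have [n] := ubnP (measure it); elim: n it => // n IH it; rewrite ltnS => le_n itC.
move=> Us z a itE.
have wf_it : @wf_item P N it by rewrite itE; split; [exists a|exact: wf_path].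
have sub it' : it' \in subitems it -> correct_at v it'.
  move=> it's; apply: IH; last exact: closedC it's.
  by have [_ /leq_trans] := wf_subitems wf_it it's; apply.
rewrite {IH le_n wf_it}; subst it.
case: a itC sub => [p|b|b|b c|i b|n' U e b] itC.
- case: Us z itC => [|[n' U] Us] z itC sub; first by rewrite v_var.
  have [f0 f1] := fld_Var N p; move: sub;
    rewrite v_local// /local_value /subitems f0 f1.
  rewrite [path z]/= /= epostE => sub.
  have {}sub := sub _ (mem_head _ _).
  by rewrite -(sub _ (val z).1 (post U (val z).2 p))//.
- have [f0 f1] := fld_Neg b; rewrite v_local// /local_value /subitems f0 f1 /= => sub.
  by rewrite -(sub _ (mem_head _ _) _ z b).
- have [f0 f1] := fld_Inc b; rewrite v_local// /local_value /subitems f0 f1 /= => sub.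
  by rewrite -(sub _ (mem_head _ _) _ z b).
- have [f0 f1 f2] := fld_And b c;
  rewrite v_local// /local_value /subitems f0 f1 f2 /= => sub.
  rewrite -(sub (code_form b, path z) _ _ z b) ?mem_head//.
  by rewrite -(sub (code_form c, path z) _ _ z c) ?inE ?eqxx ?orbT.
- have [f0 f1 f2] := fld_Know i b; rewrite v_know// /subitems f0 f1 f2 /= => sub.
  have subv r it : r \in variants (enum_rank i) (path z) ->
      it \in (code_form b, r) :: exitems r -> correct_at v it.
    move=> rv itr; apply: sub; apply/flattenP; eexists; last exact: itr.
    by apply/mapP; exists r.
  (* The accessible states of the iterated update are the accessible states of [M] paired with a
     variant executable there, so both infima have the same lower bounds. *)
  apply: tmin_antisym => d; rewrite !tmin_tinf; split=> h _ [t st <-].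
    rewrite /body_value f1 f2; apply/tmin_all => r.
    rewrite mem_filter => /andP[ex rv].
    have [|z' z't z'r] := variant_lift rv _ ex.
      by move=> it itr; apply: (subv r) => //; rewrite inE itr orbT.
    rewrite -z't -(subv r _ rv (mem_head _ _) _ z' b) ?z'r//.
    by apply: h; exists z' => //; apply/acc_updates; rewrite z't z'r.
  have /acc_updates[bt pv] := st.
  have := h (body_value (v (base t)) (code_form (Know i b), path z)).
  have -> : [set body_value (v t0) (code_form (Know i b),
    path z) | t0 in acc i (base z)]
    (body_value (v (base t)) (code_form (Know i b), path z)) = True.
    by apply/propext; split=> // _; exists (base t).
  move=> /(_ I); rewrite /body_value f1 f2 => /tmin_all /(_ (path t)).
  rewrite -(subv _ _ pv (mem_head _ _) _ t b)//; apply.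
  rewrite mem_filter pv andbT; apply: path_exists_at => it itr.
  by apply: (subv (path t)) => //; rewrite inE itr orbT.
- have [f0 f1 f2] := fld_Upd U e b;
  rewrite v_local// /local_value /subitems f0 f1 f2 /=.
  rewrite epreE => sub.
  rewrite -(sub (code_form (pre U e), path z) _ _ z (pre U e)) ?mem_head//.
  rewrite -/(eval (Upd U e b) z) eval_Upd.
  case: insubP => [y dy yE|/negbTE nd]; last by rewrite nd.
  rewrite dy.
  pose y' : updates M (existT _ n' U :: Us) := y.
  have py : path y' = (code_umodel U, nat_of_ord e) :: path z by rewrite /= yE.
  have by' : base y' = base z by rewrite /= yE.
  have cy : correct_at v (code_form b, path y').
    by apply: sub; rewrite py !inE eqxx orbT.
  by rewrite -py -by'; exact: (cy _ y' b).
Qed.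
End Truth.
End IteratedUpdate.

Section TypeLists.
Implicit Types (C : seq item) (t : seq tv) (T : seq (seq tv)).

Lemma mem_all_types C t : size t = size C -> t \in all_types C.
Proof.
elim: C t => [|it C IH] [|c t] //= [/IH tC]; apply/flattenP.
exists [:: V0 :: t; Vh :: t; V1 :: t]; first by apply/mapP; exists t.
by rewrite !inE !eqseq_cons eqxx !andbT; case: c.
Qed.

Lemma mem_sublists T (p : pred (seq tv)) : [seq t <- T | p t] \in sublists T.
Proof.
elim: T => //= t T IH; rewrite mem_cat; case: ifP => _; last by rewrite IH orbT.
by apply/orP; left; apply/mapP; exists [seq t <- T | p t].
Qed.

Lemma read_map C (v : item -> tv) it : it \in C ->
  read C [seq v it | it <- C] it = v it.
Proof. by move=> itC; rewrite /read (nth_map it) ?index_mem// nth_index. Qed.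

Lemma agreeP i C t t' : reflect
  (forall it, it \in C -> is_know it -> fld it.1 1 = i -> read C t it = read C t' it)
  (agree i C t t').
Proof.
apply: (iffP allP) => h it itC.
  by move=> k ki; have := h _ itC; rewrite k ki eqxx /= => /eqP.
by have [k|//] := boolP (is_know it); have [ki|//] := eqVneq; rewrite /= h.
Qed.

End TypeLists.

(** * The types realized in a model yield a candidate *)

Section Evaluator.
Context (P : countType) (N : finType).
Local Notation F := (form P N).
Context (M : model P N).
Implicit Types (s : M) (a : F) (it : item) (k : nat).

Definition same_agent it s t := exists2 i : N, fld it.1 1 = enum_rank i & acc i s t.

(* The values of the items at the states of an arbitrary model, computed on codes. *)
Definition ev_step (v : M -> item -> tv) s it : tv :=
  if is_know it then tinf [set body_value (v t) it | t in same_agent it s]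
  else if (fld it.1 0 == 0) && (it.2 == [::]) then
    oapp (valu s) V0 (unpickle (fld it.1 1))
  else local_value (v s) it.

(** Fuel replaces structural recursion, since items decrease only in [measure]. For well-formed
    items any fuel above the measure gives the same value. *)
Fixpoint ev k s it : tv := if k is k'.+1 then ev_step (ev k') s it else V0.

Lemma ev_step_congr v v' s it :
  (forall it' t, it' \in subitems it -> v t it' = v' t it') ->
  ev_step v s it = ev_step v' s it.
Proof.
move=> h; rewrite /ev_step; case: ifP => [k|nk].
  congr tinf; apply/seteqP; split=> _ [t st <-]; exists t => //;
    by apply: body_value_congr => // it' it's; rewrite h.
case: ifP => // nv.
rewrite /local_value; move: nk nv h; rewrite /is_know /subitems.
case: (fld it.1 0) => [|[|[|[|[|l]]]]] //= _ nv h.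
- by case: it.2 nv h => [//|w r] _ h; rewrite h ?mem_head.
- by rewrite h ?mem_head.
- by rewrite h ?mem_head.
- by rewrite !h// !inE eqxx ?orbT.
- by rewrite !h// !inE eqxx ?orbT.
Qed.

Lemma ev_stable k k' s it : @wf_item P N it -> measure it < k -> measure it < k' ->
  ev k s it = ev k' s it.
Proof.
elim: k k' s it => // k IH [//|k'] s it wf; rewrite !ltnS => lk lk' /=.
apply: ev_step_congr => it' t it's; have [wf' lt] := wf_subitems wf it's.
by apply: IH => //; exact: leq_trans lt _.
Qed.

Definition value s it := ev (measure it).+1 s it.

Lemma valueE s it : @wf_item P N it -> value s it = ev_step value s it.
Proof.
move=> wf; apply: ev_step_congr => it' t it's.
by have [wf' lt] := wf_subitems wf it's; exact: ev_stable.
Qed.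

Lemma value_local s it : @wf_item P N it -> value s it = local_value (value s) it.
Proof.
move=> wf; have [k|nk] := boolP (is_know it).
  by rewrite /local_value; move: k; rewrite /is_know => /eqP ->.
have [|nv] := boolP ((fld it.1 0 == 0) && (it.2 == [::])).
  by rewrite /local_value => /andP[-> /eqP ->].
by rewrite [LHS]valueE// /ev_step (negbTE nk) (negbTE nv).
Qed.

Lemma value_know s it : @wf_item P N it -> is_know it ->
  value s it = tinf [set body_value (value t) it | t in same_agent it s].
Proof. by move=> wf k; rewrite valueE// /ev_step k. Qed.

Lemma value_var s p : value s (code_form (Var N p), [::]) = valu s p.
Proof.
have [f0 f1] := fld_Var N p; rewrite valueE; last by split=> //; exists (Var N p).
by rewrite /ev_step /is_know f0 f1 /= pickleK.
Qed.

Lemma value_form s a : value s (code_form a, [::]) = eval a s.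
Proof.
have [aC wC cC] := closureP a.
symmetry; apply: (@truth _ _ M value (closure (code_form a)) _ _ _ _ _ aC [::] s a)
  => //.
- by move=> s' p _; exact: value_var.
- by move=> s' it /wC; exact: value_local.
move=> s' i b r /wC wf; have [f0 f1 f2] := fld_Know i b.
rewrite value_know// /is_know ?f0//; congr tinf.
suff -> : same_agent (code_form (Know i b), r) s' = acc i s' by [].
apply/funext => t; apply/propext; split=> [[j]|st]; last by exists i.
by rewrite f1 => /ord_inj/enum_rank_inj ->.
Qed.

Lemma same_agent_value it s t : @wf_item P N it -> is_know it ->
  same_agent it s t -> value s it = value t it.
Proof.
move=> wf k [i fi st]; rewrite !value_know//; congr tinf.
have [R S T] := acc_equiv M i.
suff -> : same_agent it s = same_agent it t by [].
apply/funext => u; apply/propext; split=> -[j fj ju]; exists j => //; move: ju;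
  have -> : j = i by apply/enum_rank_inj/ord_inj; rewrite -fi -fj.
  by apply: T; exact: S.
exact: T.
Qed.

Definition type_at C s := [seq value s it | it <- C].

Lemma wf_know it : @wf_item P N it -> is_know it ->
  exists (i : N) (b : F), it.1 = code_form (Know i b).
Proof.
case=> -[a aE] _; rewrite /is_know aE; case: a {aE} => [p|b|b|b c|i b|n U e b].
- by have [->] := fld_Var N p.
- by have [->] := fld_Neg b.
- by have [->] := fld_Inc b.
- by have [->] := fld_And b c.
- by move=> _; exists i, b.
- by have [->] := fld_Upd U e b.
Qed.

(** The list of all types realized in [M] is good: true values are locally correct, and reflexivity
    bounds each K-value by the body value at the same state. *)
Lemma candidates_complete a s : designated (eval a s) ->
  candidates (code_form a) (closure (code_form a)) <> [::].
Proof.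
move=> das; set x := code_form a; set C := closure x.
have [xC wC cC] : _ := closureP a.
pose T := [seq t <- all_types C | `[< exists s, t = type_at C s >]].
suff : T \in candidates x C by case: candidates.
have inT t : type_at C t \in T.
  rewrite mem_filter mem_all_types ?size_map// andbT; apply/asboolP; by exists t.
rewrite mem_filter mem_sublists andbT; apply/andP; split; last first.
  apply/hasP; exists (type_at C s); first exact: inT.
  by rewrite /realizes read_map// value_form.
have body t it : it \in C -> is_know it ->
    body_value (read C (type_at C t)) it = body_value (value t) it.
  by move=> itC k; apply: body_value_congr => // it' /(cC _ _ itC) it'C;
    rewrite read_map.
apply/allP => _ /[!mem_filter]/andP[/asboolP[t ->] _]; apply/andP; split.
  apply/allP => it itC; rewrite read_map//; apply/andP; split.
    rewrite (@local_value_congr _ (value t)) ?read_map// -?value_local//;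
      first exact: wC.
    by move=> it' /(cC _ _ itC) it'C; rewrite read_map.
  have [k /=|//] := boolP (is_know it); rewrite body//.
  rewrite [value t it]value_know; [|exact: wC|by []].
  have [i [b itE]] := wf_know (wC _ itC) k; have [f0 f1 f2] := fld_Know i b.
  apply/eqP/tinf_le; exists t => //; exists i; first by rewrite itE.
  by have [R _ _] := acc_equiv M i; exact: R.
apply/allP => it itC; have [k /=|//] := boolP (is_know it); rewrite read_map//.
have [i [b itE]] := wf_know (wC _ itC) k.
have [f0 f1 f2] := fld_Know i b.
pose A := [set body_value (value t) it | t in same_agent it t].
have At : A (body_value (value t) it).
  exists t => //; exists i; first by rewrite itE.
  by have [R _ _] := acc_equiv M i; exact: R.
(* The set is nonempty, so its infimum is attained at some [u], whose type is the required
   witness. *)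
have := tinf_mem At; rewrite -value_know; [|exact: wC|by []].
move=> [u tu uE].
apply/hasP; exists (type_at C u); first exact: inT.
rewrite body// uE eqxx andbT; apply/agreeP => it' it'C k' fi'.
rewrite !read_map//; apply: same_agent_value => //; first exact: wC.
by case: tu => j fj tu; exists j => //; rewrite fi'.
Qed.
End Evaluator.

(** * A good list of types is a finite model *)

Section FiniteModel.
Context (P : countType) (N : finType).
Local Notation F := (form P N).
Context (a : F).
Local Notation C := (closure (code_form a)).
Context (t0 : seq tv) (T' : seq (seq tv)).
Local Notation T := (t0 :: T').
Context (goodT : good C T).
Local Notation n := (size T').
Implicit Types (x y z : 'I_n.+1) (it : item).

Definition type_of x := nth [::] T x.

Lemma type_of_mem x : type_of x \in T.
Proof. by rewrite mem_nth//= ltn_ord. Qed.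

Lemma type_of_onto t : t \in T -> exists x, type_of x = t.
Proof.
move=> tT; have lt : index t T < n.+1 by rewrite -[n.+1]/(size T) index_mem.
by exists (Ordinal lt); rewrite /type_of nth_index.
Qed.

Lemma agree_equiv (i : N) : let R x y :=
  agree (enum_rank i) C (type_of x) (type_of y) in
  [/\ reflexive R, symmetric R & transitive R].
Proof.
split=> [x|x y|y x z].
- by apply/agreeP.
- by apply/agreeP/agreeP => h it itC k ki; rewrite h.
- by move=> /agreeP h /agreeP h'; apply/agreeP => it itC k ki; rewrite h// h'.
Qed.

Definition types_frame : frame N n := Frame agree_equiv.

Lemma wf_var it : @wf_item P N it -> fld it.1 0 = 0 ->
  exists p : P, it.1 = code_form (Var N p).
Proof.
case=> -[b bE] _; rewrite bE; case: b {bE} => [p|b|b|b c|i b|m U e b].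
- by exists p.
- by have [->] := fld_Neg b.
- by have [->] := fld_Inc b.
- by have [->] := fld_And b c.
- by have [->] := fld_Know i b.
- by have [->] := fld_Upd U e b.
Qed.

(** The procedure handles only numbers, while [fval] lists elements of [P]; this recovers the
    variables in the order in which [code_types] lists them. *)
Lemma var_items (l : seq item) : (forall it, it \in l -> @wf_item P N it) ->
  exists ps : seq P, [seq it <- l | (fld it.1 0 == 0) && (it.2 == [::])] =
    [seq (code_form (Var N p), [::]) | p <- ps].
Proof.
elim: l => [|it l IH] wf; first by exists [::].
have [|ps psE] := IH; first by move=> it' it'l; apply: wf; rewrite inE it'l orbT.
rewrite /=; case: ifP => [/andP[/eqP v0 /eqP s0]|_]; last by exists ps.
have [p pE] := wf_var (wf _ (mem_head _ _)) v0.
exists (p :: ps); rewrite psE map_cons; congr cons.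
by rewrite [it]surjective_pairing pE s0.
Qed.

Lemma lookup_map (A : Type) (d : A) (g : P -> A) (ps : seq P) p :
  p \in ps -> lookup d [seq (q, g q) | q <- ps] p = g p.
Proof.
by elim: ps => //= q ps IH; rewrite inE; case: eqVneq => [->|_ /IH].
Qed.

Lemma map_types (A : Type) (g : seq tv -> A) :
  [seq g t | t <- T] = [seq g (type_of x) | x <- enum 'I_n.+1].
Proof.
rewrite -[in LHS](mkseq_nth [::] T) /mkseq -[size T]/(n.+1) -val_enum_ord -!map_comp.
exact: eq_map.
Qed.

Lemma map_agents (A : Type) (g : nat -> A) :
  [seq g i | i <- iota 0 #|N|] = [seq g (enum_rank i) | i <- enum N].
Proof.
rewrite -val_enum_ord -map_comp;
  have -> : enum 'I_#|N| = [seq enum_rank i | i <- enum N].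
  apply: (inj_map val_inj); rewrite val_enum_ord.
  apply: (@eq_from_nth _ 0) => [|k];
    first by rewrite size_iota !size_map cardE ?enumT.
  rewrite size_iota => kN; rewrite nth_iota// add0n -map_comp.
  have := nth_image 0 (val \o enum_rank) (Ordinal kN); rewrite /image_mem /= => ->.
  by rewrite enum_valK.
by rewrite -map_comp.
Qed.

(** States are positions in the list of types, accessibility is [agree], and the valuation is read
    off the variable items; [truth] then applies to [read]. *)
Lemma finite_model : exists M : fmodel P N n,
  code_fmodel M = code_types #|N| C T /\
  forall x, @eval P N a (model_of M) x = read C (type_of x) (code_form a, [::]).
Proof.
have [aC wC cC] := closureP a; have [ps psE] := var_items wC.
pose var (p : P) : item := (code_form (Var N p), [::]).
exists (FModel types_frame (fun x =>
  [seq (p, read C (type_of x) (var p)) | p <- ps])).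
split.
  rewrite /code_fmodel /code_types [fframe _]/= [fval _]/= /code_frame map_agents psE.
  congr (code [:: _; code _; code _]).
    apply: eq_map => i; rewrite map_types; congr code; apply: eq_map => x.
    by rewrite map_types.
  rewrite map_types; apply: eq_map => x.
  rewrite -!map_comp; congr code; apply: eq_map => p /=.
  by have [_ ->] := fld_Var N p.
set M := FModel _ _ => x; pose v (y : model_of M) it := read C (type_of y) it.
have okT y : locally_ok C (type_of y) /\ witnessed C T (type_of y).
  by have /andP[] := allP goodT _ (type_of_mem y).
apply: (@truth _ _ (model_of M) v C _ _ _ _ _ aC [::] x a) => //.
- move=> y p pC; rewrite /v [RHS]/=.
  have : p \in ps.
    have : var p \in [seq it <- C | (fld it.1 0 == 0) && (it.2 == [::])].
      by rewrite mem_filter pC andbT; have [-> _] := fld_Var N p.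
    rewrite psE => /mapP[q qps pq].
    have pq1 : code_form (Var N p) = code_form (Var N q) := congr1 fst pq.
    suff /(pcan_inj pickleK) -> : pickle p = pickle q by [].
    by rewrite -(proj2 (fld_Var N p)) -(proj2 (fld_Var N q)) pq1.
  by move/(lookup_map V0 (fun p => read C (type_of y) (var p))) => ->.
- by move=> y it itC; have [/allP/(_ _ itC)/andP[/eqP]] := okT y.
move=> y i b r kC; set it : item := (_, _); have [f0 f1 f2] := fld_Know i b.
have k : is_know it by rewrite /is_know f0.
symmetry; have [_ /allP/(_ _ kC)/orP[]] := okT y; first by rewrite k.
move=> /hasP[t /type_of_onto[z <-] /andP[]]; rewrite f1 => yz /eqP vz.
(* The witness [z] attains the K-value. Any other related type shares this value and, being locally
   correct, has a body value at least as large. *)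
apply: tinf_eq; first by exists z.
move=> _ [z' /agreeP yz' <-]; have [/allP/(_ _ kC)/andP[_]] := okT z';
  rewrite k /= => + _.
by rewrite -(yz' _ kC k) => [/eqP|]; rewrite ?f1.
Qed.
End FiniteModel.

Section Main.
Context (P : countType) (N : finType).
Local Notation F := (form P N).

Lemma total_frame_equiv n (i : N) : let R := (fun _ _ => true) : rel 'I_n.+1 in
  [/\ reflexive R, symmetric R & transitive R].
Proof. by []. Qed.

Definition point_model : fmodel P N 0 :=
  FModel (Frame (@total_frame_equiv 0)) (fun=> [::]).

Definition decide_form (x : nat) := decide (code_fmodel point_model) #|N| x.

Lemma decide_form_recursive : recursive (fun v : 1.-tuple nat =>
  decide_form (tnth v ord0)).
Proof.
have [g rg gE] := comp_decide (code_fmodel point_model) #|N|.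
by apply: recursive_ext rg => v; rewrite gE.
Qed.

Theorem decidability : exists d : 1.-tuple nat -> nat, decides_sat P N d.
Proof.
exists (fun v => decide_form (tnth v ord0)); split;
  first exact: decide_form_recursive.
move=> a; rewrite (tnth_nth 0) /= /decide_form /decide.
have sat := @candidates_complete P N _ a.
move: sat; case E: candidates => [|T l] sat.
  exists false, 0, point_model, ord0; split=> //.
  have unsat : ~ satisfiable a by move=> [M [s /sat]].
  (* A nonzero value is designated and would make [a] satisfiable. *)
  split=> //; apply/eqP; apply: contra_notT unsat => nz.
  exists (model_of point_model), ord0; by case: eval nz.
have : T \in candidates (code_form a) (closure (code_form a)) by rewrite E mem_head.
rewrite mem_filter => /andP[/andP[gT rT] _].
case: T gT rT {E sat} => [//|t0 T'] gT rT.
have [M [codeM evalM]] := finite_model gT.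
have lt : find (fun t => realizes (code_form a) (closure (code_form a)) t) (t0 ::
  T') <
    (size T').+1 by rewrite -[(size T').+1]/(size (t0 :: T')) -has_find.
exists true, (size T'), M, (Ordinal lt); split; first by rewrite codeM.
suff d : designated (@eval P N a (model_of M) (Ordinal lt)).
  by split=> //; exists (model_of M), (Ordinal lt).
by rewrite evalM; exact: (nth_find [::] rT).
Qed.

End Main.

Theorem mainTheorem7 (P : countType) (N : finType) :
  (forall (G : set (form P N)) (a : form P N), derives G a <-> entails G a) /\
  (forall (G : set (form P N)) (a : form P N), entails G a ->
     exists G' : set (form P N),
       [/\ finite_set G', G' `<=` G & entails G' a]) /\
  (exists d : 1.-tuple nat -> nat, decides_sat P N d).
Proof.
split=> [G a|]; first by split; [exact: soundness|exact: completeness].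
by split; [exact: compactness|exact: decidability].
Qed.
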